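(* Let $\mathcal{G}_{11}$, $\mathcal{G}_{11}^\perp$, $\mathcal{G}_{12}$ be the ternary codes described in the context, and for $m\ge1$ let $\mathcal{G}_{11,m}$, $\mathcal{G}_{11,m}^\perp$, $\mathcal{G}_{12,m}$ be their $m$-lifted codes over $\mathbb{F}_{3^m}$ (so $\mathcal{G}_{n,1}$ is the original code). Then: (i) The following codes are all uniformly packed in the wide sense (UPWS) and near-MDS (NMDS): the family $\mathcal{D}_1$ consisting of $\mathcal{G}_{12,1}=[12,6,6]_3 3$ and $\mathcal{G}_{12,m}=[12,6,6]_{3^m}6$ (covering radius $6$) for all $m\ge6$; and the family $\mathcal{D}_2$ consisting of $\mathcal{G}_{11,1}=[11,6,5]_32$ and $\mathcal{G}_{11,m}=[11,6,5]_{3^m}5$ (covering radius $5$) for all $m\ge4$. (ii) The following NMDS codes are not UPWS: $\mathcal{G}_{11,m}^\perp=[11,5,6]_{3^m}$ for every $m\ge2$; $\mathcal{G}_{11,m}=[11,6,5]_{3^m}4$ (covering radius $4$) for $m=2,3$; $\mathcal{G}_{12,2}=[12,6,6]_{3^2}4$ and $\mathcal{G}_{12,3}=[12,6,6]_{3^3}5$. (iii) The code $\mathcal{G}_{11}^\perp=[11,5,6]_35$ is completely regular. The code obtained from $\mathcal{G}_{11}^\perp$ by puncturing (deleting) coordinate $11$ is a self-dual completely regular $[10,5,5]_34$ code. Moreover, the set of all codewords of $\mathcal{G}_{11}$ of weights $0,6,9$ coincides with $\mathcal{G}_{11}^\perp$. (iv) For every $m\ge1$, $A_6(\mathcal{G}_{12,m})=A^{\max}_6(12,6,3^m)=\binom{12}{5}\frac{3^m-1}{6}$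 and $A_6(\mathcal{G}_{11,m}^\perp)=A^{\max}_6(11,5,3^m)=\binom{11}{4}\frac{3^m-1}{5}$, i.e. these codes have the maximum possible number of minimum weight codewords for NMDS codes with their parameters. Moreover, for $m=1$ these maximal numbers coincide with the minimal possible number of codewords of weight $6$ among all (not necessarily NMDS) codes with the same length, dimension and minimum distance $6$. Also, the Golay code $\mathcal{G}_{11}=[11,6,5]_3$ has the minimal possible number of codewords of minimum weight $5$ among all codes with length $11$, dimension $6$ over $\mathbb{F}_3$ and minimum distance $5$. (v) For every $m\ge1$, the codes $\mathcal{G}_{12,m}$ and $\mathcal{G}_{11,m}^\perp$ have no codewords of weight $7$.
   Context: $\mathbb{F}_q$ is the field with $q$ elements. An $[n,k,d]_qR$ code is a $k$-dimensional linear subspace of $\mathbb{F}_q^n$ with minimum Hamming distance $d$ and covering radius $R$ (the least integer such that every vector of $\mathbb{F}_q^n$ is within Hamming distance $R$ of a codeword). $C^\perp$ denotes the dual code with respect to the standard inner product. $A_i(C)$ is the number of codewords of Hamming weight $i$. For a linear code $C$ over $\mathbb{F}_q$ with parity check matrix $H\in\mathbb{F}_q^{(n-k)\times n}$ and $m\ge1$, the $m$-lifted code $C_m$ is the linear code over $\mathbb{F}_{q^m}$ with the same parity check matrix, $C_m=\{x\in\mathbb{F}_{q^m}^n: Hx^T=0\}$ (equivalently the $\mathbb{F}_{q^m}$-span of $C$); it has the same length, dimension and minimum distance as $C$, and $C_1=C$. A linear $[n,k,d]_q$ code is near-MDS (NMDS) if $d(C)+d(C^\perp)=n$ with $d(C)=n-k$.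 For an NMDS $[n,k,d]_q$ code, $A_d(C)\le A^{\max}_d(n,k,q):=\binom{n}{k-1}\frac{q-1}{k}$. For $v\in\mathbb{F}_q^n$, $B_j(v,C)$ is the number of codewords at Hamming distance $j$ from $v$. A code $C$ with covering radius $R$ is uniformly packed in the wide sense (UPWS) if there exist rationals $\beta_0,\dots,\beta_R$ with $\sum_{j=0}^R\beta_jB_j(v,C)=1$ for every $v\in\mathbb{F}_q^n$. A code $C$ with covering radius $R$ is completely regular (CR) if for every $v$ and every $j$, $B_j(v,C)$ depends only on $j$ and $d(v,C)$. $\mathcal{G}_{11}$ is the ternary Golay code, the $[11,6,5]_32$ code over $\mathbb{F}_3$ with generator matrix $[I_6\mid M_{11}]$, $M_{11}=\begin{pmatrix}2&2&2&2&2\\2&2&1&1&0\\2&1&2&0&1\\1&2&0&2&1\\1&0&2&1&2\\0&1&1&2&2\end{pmatrix}$; $\mathcal{G}_{11}^\perp$ is its dual, an $[11,5,6]_35$ code. $\mathcal{G}_{12}$ is the extended ternary Golay code, the $[12,6,6]_33$ code with generator matrix $[I_6\mid M_{12}]$, $M_{12}=\begin{pmatrix}0&1&1&1&1&1\\1&0&1&2&2&1\\1&1&0&1&2&2\\1&2&1&0&1&2\\1&2&2&1&0&1\\1&1&2&2&1&0\end{pmatrix}$.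
   Formalization: In (iii), ''self-dual'' is replaced by ''monomially equivalent to its dual'': strict self-duality is false, since a weight-5 codeword of the punctured [10,5,5]_3 code has inner product 5 ≠ 0 with itself in F_3. *)

(* Defs.v *)
From HB Require Import structures.
From mathcomp Require Import all_boot all_order all_fingroup all_algebra.
Set Implicit Arguments.
Unset Strict Implicit.
Unset Printing Implicit Defensive.
Import Order.TTheory GRing.Theory Num.Theory.
Local Open Scope ring_scope.

(* A linear code of length n over a finite field F is a subspace of F^n, i.e.
   a term C : {vspace 'rV[F]_n}; its dimension is \dim C.                     *)

Section Codes.
Variables (F : finFieldType) (n : nat).
Implicit Types (C D : {vspace 'rV[F]_n}) (v w x : 'rV[F]_n).

Definition wt x : nat := #|[set i | x 0 i != 0]|.
Definition hdist x v : nat := #|[set i | x 0 i != v 0 i]|.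

(* Distances are at most n, so the default n.+1 is reached only when there are
   no two distinct codewords.                                                 *)
Definition min_dist C : nat :=
  \big[minn/n.+1]_(p : 'rV[F]_n * 'rV[F]_n |
                    [&& p.1 \in C, p.2 \in C & p.1 != p.2]) hdist p.1 p.2.

(* Here the default n is harmless: 0 is always a codeword. *)
Definition dist_code v C : nat := \big[minn/n]_(c in C) hdist v c.

Definition covers C (r : nat) : bool :=
  [forall v : 'rV[F]_n, [exists c : 'rV[F]_n, (c \in C) && (hdist v c <= r)%N]].

Lemma ex_covers C : exists r, covers C r.
Proof.
exists n; apply/forallP => v; apply/existsP; exists 0; rewrite mem0v /=.
by apply: leq_trans (max_card _) _; rewrite card_ord.
Qed.

Definition covering_radius C : nat := ex_minn (ex_covers C).

Definition weight_count (i : nat) C : nat := #|[set c in C | wt c == i]|.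
Definition dist_count (j : nat) v C : nat := #|[set c in C | hdist v c == j]|.

Definition dual C : {vspace 'rV[F]_n} :=
  (\bigcap_(c in C) lker (linfun (mulmxr c^T : 'rV[F]_n -> 'M[F]_1)))%VS.

Definition gen_code k (G : 'M[F]_(k, n)) : {vspace 'rV[F]_n} :=
  limg (linfun (mulmxr G : 'rV[F]_k -> 'rV[F]_n)).

(* { x | H x^T = 0 }, written with row vectors as x H^T = 0 *)
Definition check_code r (H : 'M[F]_(r, n)) : {vspace 'rV[F]_n} :=
  lker (linfun (mulmxr H^T : 'rV[F]_n -> 'rV[F]_r)).

(* One parity check matrix of C, with \dim (dual C) = n - \dim C rows; by
   lift_codeE below the choice is irrelevant for the lifted codes.            *)
Definition parity_mx C : 'M[F]_(\dim (dual C), n) :=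
  \matrix_(i < \dim (dual C)) tnth (vbasis (dual C)) i.

Definition near_MDS C : Prop :=
  (min_dist C + min_dist (dual C) = n)%N /\ min_dist C = (n - \dim C)%N.

Definition UPWS C : Prop :=
  exists beta : 'I_(covering_radius C).+1 -> rat,
  forall v, \sum_j beta j * (dist_count j v C)%:R = 1.

Definition completely_regular C : Prop :=
  forall v w, dist_code v C = dist_code w C ->
  forall j, dist_count j v C = dist_count j w C.

(* Monomial equivalence: permute the coordinates and rescale each of them. *)
Definition code_equiv C D : Prop :=
  exists (s : {perm 'I_n}) (a : 'I_n -> F), (forall i, a i != 0) /\
  forall x, (x \in C) = (\row_i (a i * x 0 (s i)) \in D).

(* A code C with C = dual C in the strict sense cannot have the parameters
   [10,5,5] over F_3: it would contain a word of weight 5, whose inner product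
   with itself is 5 <> 0.  "Self-dual" is therefore understood up to
   equivalence of codes.                                                      *)
Definition self_dual_equiv C : Prop := code_equiv C (dual C).

Definition code_params C (k d : nat) : Prop := \dim C = k /\ min_dist C = d.

Definition code_paramsR C (k d R : nat) : Prop :=
  code_params C k d /\ covering_radius C = R.

Lemma mem_dual C x : x \in dual C <-> (forall c, c \in C -> x *m c^T = 0).
Proof.
rewrite /dual memvE; split => [/subv_bigcapP H c cC | H].
  by have := H c cC; rewrite -memvE memv_ker lfunE => /eqP.
by apply/subv_bigcapP => c cC; rewrite -memvE memv_ker lfunE /= H.
Qed.

Lemma mem_check_code r (H : 'M[F]_(r, n)) x :
  (x \in check_code H) = (H *m x^T == 0).
Proof. by rewrite memv_ker lfunE /= -trmx_eq0 trmx_mul trmxK. Qed.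

Lemma mem_gen_code k (G : 'M[F]_(k, n)) x :
  (x \in gen_code G) = (x <= G)%MS.
Proof.
apply/memv_imgP/submxP => [[u _ ->]|[u ->]]; exists u; rewrite ?memvf //.
  by rewrite lfunE.
by rewrite lfunE.
Qed.

Lemma check_code_sub r s (H : 'M[F]_(r, n)) (K : 'M[F]_(s, n)) :
  (check_code K <= check_code H)%VS -> (H <= K)%MS.
Proof.
move=> KH; rewrite submxE -trmx_eq0; apply/eqP/row_matrixP => i.
rewrite row0 trmx_mul row_mul.
have : row i (cokermx K)^T \in check_code H.
  apply: (subvP KH); rewrite mem_check_code -trmx_eq0 trmx_mul trmxK -row_mul.
  by rewrite -trmx_mul mulmx_coker trmx0 row0.
by rewrite mem_check_code -trmx_eq0 trmx_mul trmxK => /eqP.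
Qed.

Lemma check_code_parity_mx C : check_code (parity_mx C) = C.
Proof.
set G : 'M[F]_(\dim C, n) := \matrix_(i < \dim C) tnth (vbasis C) i.
have rowG i : row i G \in C by rewrite rowK vbasis_mem ?mem_tnth.
have GC x : (x <= G)%MS -> x \in C.
  by case/submxP => u ->; rewrite mulmx_sum_row memv_suml // => i _; exact: memvZ.
have CG c : c \in C -> (c <= G)%MS.
  move=> /coord_vbasis ->; apply: summx_sub => i _; apply: scalemx_sub.
  by rewrite -tnth_nth -(rowK (fun i => tnth (vbasis C) i)) row_sub.
have orth x : x \in check_code (parity_mx C) <->
              (forall y, y \in dual C -> y *m x^T = 0).
  rewrite mem_check_code; split => [/eqP Px y | H].
    move/coord_vbasis => ->; rewrite mulmx_suml big1 // => i _.
    rewrite -scalemxAl -tnth_nth.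
    by rewrite -(rowK (fun i => tnth (vbasis (dual C)) i)) -row_mul Px row0 scaler0.
  apply/eqP/row_matrixP => i; rewrite row_mul row0 rowK H //.
  by rewrite vbasis_mem ?mem_tnth.
apply/vspaceP => x; apply/idP/idP => [/orth Hx | xC]; last first.
  apply/orth => y /mem_dual /(_ _ xC) //.
apply: GC; rewrite submxE -trmx_eq0; apply/eqP/row_matrixP => i.
rewrite row0 trmx_mul row_mul; apply: Hx; apply/mem_dual => c /CG.
rewrite submxE => /eqP cG; rewrite -row_mul -trmx_mul cG trmx0 row0 //.
Qed.

End Codes.

(* The lifted code along iota : F -> L.  A ring morphism between finite fields
   exists iff L is an extension of F, and is then the inclusion up to an
   automorphism.                                                              *)
Definition lift_code (F L : finFieldType) (iota : {rmorphism F -> L}) (n : nat)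
    (C : {vspace 'rV[F]_n}) : {vspace 'rV[L]_n} :=
  check_code (map_mx iota (parity_mx C)).

Lemma lift_codeE (F L : finFieldType) (iota : {rmorphism F -> L}) (n r : nat)
    (C : {vspace 'rV[F]_n}) (H : 'M[F]_(r, n)) :
  check_code H = C -> lift_code iota C = check_code (map_mx iota H).
Proof.
have sub s t (A : 'M[F]_(s, n)) (B : 'M[F]_(t, n)) :
    check_code A = C -> check_code B = C ->
    (check_code (map_mx iota A) <= check_code (map_mx iota B))%VS.
  move=> eqA eqB; have /submxP[u ->] : (B <= A)%MS by apply: check_code_sub; rewrite eqA eqB.
  apply/subvP => x; rewrite !mem_check_code map_mxM -mulmxA => /eqP ->.
  by rewrite mulmx0.
by move=> HC; apply/eqP; rewrite eqEsubv !sub // check_code_parity_mx.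
Qed.

Definition puncture (F : finFieldType) (n : nat) (i : 'I_n)
    (C : {vspace 'rV[F]_n}) : {vspace 'rV[F]_(n.-1)} :=
  (linfun (col' i : 'rV[F]_n -> 'rV[F]_(n.-1)) @: C)%VS.

(* The bound A_d <= Amax n k q on the number of minimum weight codewords of
   near-MDS [n,k,d]_q codes                                                   *)
Definition Amax (n k q : nat) : rat := ('C(n, k.-1))%:R * ((q%:R - 1) / k%:R).

Definition mx_of_seq (R : pzRingType) (k l : nat) (s : seq (seq nat)) :
    'M[R]_(k, l) :=
  \matrix_(i < k, j < l) (nth 0%N (nth [::] s i) j)%:R.

Definition M11 : 'M['F_3]_(6, 5) := mx_of_seq _ _ _
  [:: [:: 2; 2; 2; 2; 2];
      [:: 2; 2; 1; 1; 0];
      [:: 2; 1; 2; 0; 1];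
      [:: 1; 2; 0; 2; 1];
      [:: 1; 0; 2; 1; 2];
      [:: 0; 1; 1; 2; 2]]%N.

Definition M12 : 'M['F_3]_(6, 6) := mx_of_seq _ _ _
  [:: [:: 0; 1; 1; 1; 1; 1];
      [:: 1; 0; 1; 2; 2; 1];
      [:: 1; 1; 0; 1; 2; 2];
      [:: 1; 2; 1; 0; 1; 2];
      [:: 1; 2; 2; 1; 0; 1];
      [:: 1; 1; 2; 2; 1; 0]]%N.

Definition golay11 : {vspace 'rV['F_3]_11} := gen_code (row_mx 1%:M M11).
Definition golay11_dual : {vspace 'rV['F_3]_11} := dual golay11.
Definition golay12 : {vspace 'rV['F_3]_12} := gen_code (row_mx 1%:M M12).

(* Main.v *)
(** For a set [T] of coordinates, Poisson summation expresses the number of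
    codewords that agree with [v] outside [T] through the dual words vanishing on
    [T]. Summed over all [T] of a given size this gives binomial moments, which
    express the distance distribution of a coset through the dual weights: if the
    number s of nonzero dual weights is at most the covering radius R, the code is
    uniformly packed with R = s, and by Fourier inversion it is not if R < s. The
    moment of order k - 1 of a near-MDS code reads
    k A_d + A_{d+1} = C(n, k-1) (q - 1), so A_d is maximal exactly when there is no
    word of weight d + 1. The minimality claims are linear programming bounds.

    A word of the lift over F_{3^m} is an m-tuple of ternary codewords, its support
    being the union of their supports. Two non-proportional words of weight 6 do
    not fit into 7 coordinates, hence no lifted word of weight 7; other unions give
    the remaining dual weights. A coset of the lift is within distance w of the
    code iff, for some w-set [T], the m ternary vectors representing it are
    orthogonal to all dual words vanishing on [T], which reduces the covering radii
    to finite checks on ternary words. *)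

Require Import Defs.
From mathcomp Require Import all_boot all_order all_fingroup all_algebra all_field.
From mathcomp Require Import zify ring lra.
Set Implicit Arguments.
Unset Strict Implicit.
Unset Printing Implicit Defensive.
Import Order.TTheory GRing.Theory Num.Theory.
Local Open Scope ring_scope.

(** * Rational additive characters and Poisson summation *)

(** Complex characters are replaced by the sum of all nontrivial ones, which takes only the values q
    - 1 and -1. Every identity then stays rational, as the packing coefficients must be; the price
    is a common factor q - 1, cancelled at the end.

    The thresholds in m come from the subcode D of dual words that annihilate the m vectors of a
    coset. If the dual has dimension R + 1 and R < d, the dual words vanishing on R positions form a
    line, so the coset is within distance R exactly when D has a nonzero word with at least R zeros.
    For R = 4, n = 11 and for R = 5, n = 12 this means a word of weight 6, since the next dual
    weight is 9. Averaging weights over D forces such a word as long as D has dimension at least 2,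
    respectively 3; for larger m, D can be generated by a word of weight 9, or be zero, and the
    radius grows.

    Length 12 with m = 2 and R = 4 escapes this scheme: the dual words vanishing on four positions
    form a plane, and no single word decides. There all pairs of ternary cosets are examined. *)

Section Support.
Variables (F : finFieldType) (n : nat).
Implicit Types (x y u v : 'rV[F]_n) (T : {set 'I_n}).

Definition supp x : {set 'I_n} := [set i | x 0 i != 0].
Definition dotp u v : F := (u *m v^T) 0 0.

Lemma wtE x : wt x = #|supp x|. Proof. by []. Qed.

Lemma hdistE x y : hdist x y = wt (x - y).
Proof. by apply: eq_card => i; rewrite !inE !mxE subr_eq0. Qed.

Lemma wt_le x : (wt x <= n)%N.
Proof. by rewrite -{2}(card_ord n) max_card. Qed.

Lemma wt_eq0 x : (wt x == 0%N) = (x == 0).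
Proof.
rewrite cards_eq0; apply/eqP/eqP => [x0|->]; last first.
  by apply/setP => i; rewrite !inE mxE eqxx.
apply/rowP => i; rewrite mxE; apply/eqP/negPn.
by move/setP/(_ i): x0; rewrite !inE => ->.
Qed.

Lemma wt0 : wt (0 : 'rV[F]_n) = 0%N. Proof. by apply/eqP; rewrite wt_eq0. Qed.

Lemma wt_gt0 x : (0 < wt x)%N = (x != 0).
Proof. by rewrite lt0n wt_eq0. Qed.

Lemma suppZ a x : a != 0 -> supp (a *: x) = supp x.
Proof. by move=> a0; apply/setP => i; rewrite !inE mxE mulf_eq0 negb_or a0. Qed.

Lemma suppP x T : reflect (forall i, i \notin T -> x 0 i = 0) (supp x \subset T).
Proof.
apply: (iffP subsetP) => H i.
  by move=> iT; apply/eqP/negPn/negP => xi; move: (H i); rewrite inE xi => /(_ isT); apply/negP.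
by rewrite inE; apply: contraR => /H ->.
Qed.

Lemma dotpE u v : dotp u v = \sum_i u 0 i * v 0 i.
Proof. by rewrite /dotp mxE; apply: eq_bigr => i _; rewrite mxE. Qed.

Lemma dotpC u v : dotp u v = dotp v u.
Proof. by rewrite !dotpE; apply: eq_bigr => i _; rewrite mulrC. Qed.

Lemma dotpDl u x v : dotp (u + x) v = dotp u v + dotp x v.
Proof. by rewrite /dotp mulmxDl mxE. Qed.

Lemma dotpDr u x v : dotp v (u + x) = dotp v u + dotp v x.
Proof. by rewrite !(dotpC v) dotpDl. Qed.

Lemma dotpZl a u v : dotp (a *: u) v = a * dotp u v.
Proof. by rewrite /dotp -scalemxAl mxE. Qed.

Lemma dotpNr u v : dotp u (- v) = - dotp u v.
Proof. by rewrite /dotp linearN /= mulmxN mxE. Qed.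

Lemma dotp0r u : dotp u 0 = 0.
Proof. by rewrite /dotp trmx0 mulmx0 mxE. Qed.

Lemma dotp0l u : dotp 0 u = 0.
Proof. by rewrite dotpC dotp0r. Qed.

Lemma dotp_mx0 u v : (u *m v^T == 0) = (dotp u v == 0).
Proof.
apply/eqP/eqP => [|d0]; first by rewrite /dotp => ->; rewrite mxE.
by apply/matrixP => i j; rewrite !ord1 [RHS]mxE.
Qed.

Lemma dotp_delta u i : dotp u (delta_mx 0 i) = u 0 i.
Proof. by rewrite /dotp trmx_delta -colE mxE. Qed.

Lemma dotp_disjoint u v : [disjoint supp u & supp v] -> dotp u v = 0.
Proof.
move/pred0P => d; rewrite dotpE big1 // => i _; apply/eqP.
by have := d i; rewrite /= !inE mulf_eq0; do 2!case: eqP => //=.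
Qed.

Lemma dualP (C : {vspace 'rV[F]_n}) x :
  reflect (forall c, c \in C -> dotp x c = 0) (x \in dual C).
Proof.
apply: (iffP idP) => [/mem_dual H c /H /eqP|H].
  by rewrite dotp_mx0 => /eqP.
by apply/mem_dual => c /H /eqP; rewrite -dotp_mx0 => /eqP.
Qed.

Lemma dualK (C : {vspace 'rV[F]_n}) : dual (dual C) = C.
Proof.
apply/vspaceP => x; apply/idP/idP => [/dualP H|xC]; last first.
  by apply/dualP => h /dualP; rewrite dotpC => ->.
rewrite -(check_code_parity_mx C) mem_check_code; apply/eqP/row_matrixP => i.
rewrite row_mul row0 rowK; apply/eqP; rewrite dotp_mx0 dotpC; apply/eqP/H.
by rewrite vbasis_mem ?mem_tnth.
Qed.

Lemma dual_gen_code k (G : 'M[F]_(k, n)) : dual (gen_code G) = check_code G.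
Proof.
apply/vspaceP => x; rewrite mem_check_code; apply/idP/eqP => [/dualP H|H].
  apply/row_matrixP => i; rewrite row_mul row0; apply/eqP.
  by rewrite dotp_mx0 dotpC H // mem_gen_code row_sub.
apply/dualP => c; rewrite mem_gen_code => /submxP [u ->].
by apply/eqP; rewrite dotpC -dotp_mx0 -mulmxA H mulmx0.
Qed.

Definition supp_space T : {vspace 'rV[F]_n} :=
  check_code (diag_mx (\row_i (i \notin T)%:R)).

Lemma mem_supp_space T x : (x \in supp_space T) = (supp x \subset T).
Proof.
rewrite mem_check_code mul_diag_mx; apply/eqP/suppP => H.
  by move=> i iT; have /matrixP/(_ i 0) := H; rewrite !mxE iT mul1r => ->.
apply/matrixP => i j; rewrite !mxE ord1.
by have [iT|/H ->] := boolP (i \in T); rewrite ?mul0r ?mulr0.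
Qed.

Lemma card_supp_space T : #|supp_space T| = (#|F| ^ #|T|)%N.
Proof.
rewrite -(card_pffun_on 0 T predT) /=.
rewrite -(@card_imset _ _ (fun f : {ffun 'I_n -> F} => \row_i f i)).
  apply: eq_card => x; rewrite mem_supp_space; apply/suppP/imsetP.
    move=> xT; exists [ffun i => x 0 i]; last by apply/rowP => i; rewrite mxE ffunE.
    apply/pffun_onP; split => [|//]; apply/supportP => i /xT.
    by rewrite ffunE.
  move=> [f /pffun_onP [/supportP fT _] ->] i iT; rewrite mxE.
  exact: fT.
by move=> f g /rowP fg; apply/ffunP => i; have := fg i; rewrite !mxE.
Qed.

End Support.

Section Psi.
Variables (F : finFieldType) (n : nat).
Implicit Types (x y u v : 'rV[F]_n) (T : {set 'I_n}) (C K : {vspace 'rV[F]_n}).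
Local Notation q := #|F|.

(* The sum of the nontrivial additive characters of [F]: it plays the role of a
   character but is rational valued. *)
Definition psi (a : F) : rat := if a == 0 then q%:R - 1 else - 1.

Lemma card_field_gt1 : (1 < q)%N. Proof. exact: card_finNzRing_gt1. Qed.

Lemma sum_psi : \sum_a psi a = 0.
Proof.
rewrite (bigD1 0) //= {1}/psi eqxx (eq_bigr (fun=> - 1)); last first.
  by move=> a /negbTE a0; rewrite /psi a0.
rewrite sumr_const.
have -> : #|[pred i : F | i != 0]| = q.-1 by have /= := cardC1 (0 : F).
have q0 : (0 < q)%N by apply: ltnW card_field_gt1.
by rewrite -{1}(prednK q0) mulrSr addrK mulNrn subrr.
Qed.

Lemma psi_sum K v a :
  \sum_(h in K) psi (a + dotp h v) =
  if v \in dual K then #|K|%:R * psi a else 0.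
Proof.
case: ifPn => [/dualP vK | vK].
  rewrite (eq_bigr (fun=> psi a)); last by move=> h /vK; rewrite dotpC => ->; rewrite addr0.
  by rewrite sumr_const mulr_natl.
have [h0 h0K h0v] : exists2 h0, h0 \in K & dotp h0 v = 1.
  have [/existsP [h /andP [hK hv]]|] :=
    boolP [exists h, (h \in K) && (dotp h v != 0)].
    by exists ((dotp h v)^-1 *: h); rewrite ?memvZ // dotpZl mulVf.
  rewrite negb_exists => /forallP H; case/negP: vK; apply/dualP => h hK.
  by apply/eqP; have := H h; rewrite hK /= negbK dotpC.
pose S b := \sum_(h in K) psi (b + dotp h v).
have Sconst b : S b = S a.
  rewrite /S (reindex_onto (fun h => h + (a - b) *: h0)
      (fun h => h - (a - b) *: h0)) /=; last by move=> h _; rewrite subrK.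
  apply: eq_big => h.
    by rewrite addrK eqxx andbT rpredDr // memvZ.
  by rewrite dotpDl dotpZl h0v mulr1 => _; congr psi; ring.
have : \sum_b S b = 0.
  rewrite exchange_big /= big1 // => h _.
  rewrite (reindex_onto (fun b => b - dotp h v) (fun b => b + dotp h v)) /=.
    by rewrite (eq_big predT psi) ?sum_psi //= => b; rewrite subrK // eqxx.
  by move=> b _; rewrite addrK.
rewrite (eq_bigr (fun=> S a)); last by move=> b _; exact: Sconst.
rewrite sumr_const => /eqP; rewrite mulrn_eq0 => /orP [|/eqP //].
by rewrite eqn0Ngt (ltnW card_field_gt1).
Qed.

Lemma supp_spaceC T : dual (supp_space F T) = supp_space F (~: T).
Proof.
apply/vspaceP => x; rewrite mem_supp_space; apply/dualP/suppP => H.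
  move=> i; rewrite inE negbK => iT; rewrite -dotp_delta; apply: H.
  rewrite mem_supp_space; apply/suppP => j jT; rewrite mxE eqxx /=.
  by case: eqP jT => // ->; rewrite iT.
move=> c; rewrite mem_supp_space => /suppP cT; rewrite dotpE big1 // => i _.
have [iT|iT] := boolP (i \in T); last by rewrite cT ?mulr0.
by rewrite H ?mul0r // inE negbK.
Qed.

(* Poisson summation over the coordinate subspace of [T]. *)
Lemma agree_outside_sum C T v :
  #|[set c in C | supp (v - c) \subset T]|%:R * ((q%:R - 1) * #|dual C|%:R) =
  (q ^ #|T|)%:R *
    \sum_(h in dual C | supp h \subset ~: T) psi (dotp h v) :> rat.
Proof.
(* The same double sum is read twice: summed over [h] first it detects [v - e] in [C], summed over
   [e] first it detects the [h] that vanish on [T]. *)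
transitivity (\sum_(e in supp_space F T) \sum_(h in dual C) psi (0 + dotp h (v - e))).
  rewrite (eq_bigr (fun e => if v - e \in C then #|dual C|%:R * psi 0 else 0)); last first.
    by move=> e _; rewrite psi_sum dualK.
  rewrite -big_mkcondr /= sumr_const /psi eqxx -[RHS]mulr_natl [_ * (q%:R - 1)]mulrC.
  congr (_%:R * _).
  rewrite -(card_imset _ (can_inj (subKr v))); apply: eq_card => e.
  rewrite inE; apply/andP/imsetP => [[eC eT]|[c]].
    by exists (v - e); rewrite ?subKr // unfold_in /= mem_supp_space subKr eT.
  by rewrite unfold_in /= mem_supp_space => /andP [cT cC] ->; rewrite subKr.
rewrite exchange_big /= mulr_sumr [RHS]big_mkcondr /=; apply: eq_bigr => h _.
under eq_bigr => e _ do
  rewrite add0r dotpDr -(scaleN1r e) (dotpC h (_ *: _)) dotpZl mulN1r -dotpNr dotpC.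
rewrite (eq_bigr (fun e => psi (dotp h v + dotp e (- h)))); last first.
  by move=> e _; rewrite (dotpC h v).
rewrite psi_sum supp_spaceC memvN mem_supp_space card_supp_space.
by case: ifP.
Qed.

End Psi.

(** * Dual codes and binomial moments *)

Section Moments.
Variables (F : finFieldType) (n : nat).
Implicit Types (x y u v : 'rV[F]_n) (T : {set 'I_n}) (C D K : {vspace 'rV[F]_n}).
Local Notation q := #|F|.

Lemma psi0 : psi (0 : F) = q%:R - 1. Proof. by rewrite /psi eqxx. Qed.

Lemma psi0_gt0 : 0 < q%:R - 1 :> rat.
Proof. by rewrite subr_gt0 ltr1n card_field_gt1. Qed.

Lemma card_vspace_gt0 C : (0 < #|C|)%N.
Proof. by apply/card_gt0P; exists 0; rewrite mem0v. Qed.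

Lemma psi_sum_short C T v :
  \sum_(h in dual C | supp h \subset ~: T) psi (dotp h v) =
  if v \in dual (dual C :&: supp_space F (~: T))%VS
  then #|(dual C :&: supp_space F (~: T))%VS|%:R * (q%:R - 1) else 0.
Proof.
rewrite -psi0 -psi_sum; apply: eq_big => [h|h _]; last by rewrite add0r.
by rewrite memv_cap mem_supp_space.
Qed.

(** Under the orthogonality condition every term of the Poisson sum is [psi 0], which is positive,
    so the number of codewords on the other side cannot be zero. *)
Lemma coset_supp_dual C T v :
  (exists2 c, c \in C & supp (v - c) \subset T) <->
  (forall h, h \in dual C -> supp h \subset ~: T -> dotp h v = 0).
Proof.
split=> [[c cC cT] h hC hT|H].
  rewrite -(subrK c v) dotpDr.
  have -> : dotp h c = 0 by move/dualP: hC; apply.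
  rewrite addr0; apply: dotp_disjoint; rewrite disjoint_subset; apply: subset_trans hT _.
  by apply/subsetP => i; rewrite in_setC; apply/contra/(subsetP cT).
have := agree_outside_sum C T v; rewrite psi_sum_short ifT; last first.
  apply/dualP => h; rewrite memv_cap mem_supp_space => /andP [hC hT].
  by rewrite dotpC H.
case: (set_0Vmem [set c in C | supp (v - c) \subset T]) => [-> /eqP|[c]]; last first.
  by rewrite inE => /andP [cC cT] _; exists c.
rewrite cards0 mul0r eq_sym !mulf_eq0 !pnatr_eq0 expn_eq0.
rewrite !eqn0Ngt card_vspace_gt0 (ltnW (card_field_gt1 F)) /=.
by rewrite (gt_eqF psi0_gt0).
Qed.

(** Poisson summation at [v = 0]: the MacWilliams identity on the level of supports. *)
Lemma card_short C T :
  (#|(C :&: supp_space F T)%VS| * #|dual C| =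
   q ^ #|T| * #|(dual C :&: supp_space F (~: T))%VS|)%N.
Proof.
have := agree_outside_sum C T 0; rewrite psi_sum_short ifT; last first.
  by apply/dualP => h _; rewrite dotp0l.
have -> : #|[set c in C | supp (0 - c) \subset T]| = #|(C :&: supp_space F T)%VS|.
  apply: eq_card => c; rewrite inE memv_cap mem_supp_space sub0r.
  by rewrite -scaleN1r suppZ // oppr_eq0 oner_eq0.
move=> H; apply/eqP; rewrite -(eqr_nat rat) !natrM; apply/eqP.
by apply: (mulfI (lt0r_neq0 psi0_gt0)); rewrite mulrCA {}H; ring.
Qed.

Lemma card_dual C : (#|C| * #|dual C| = q ^ n)%N.
Proof.
have := card_short C setT; rewrite cardsT card_ord setCT.
have -> : (C :&: supp_space F setT)%VS = C.
  by apply/vspaceP => x; rewrite memv_cap mem_supp_space subsetT andbT.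
suff -> : #|(dual C :&: supp_space F set0)%VS| = 1%N by rewrite muln1.
rewrite (@eq_card _ _ (pred1 (0 : 'rV[F]_n))) ?card1 // => x.
rewrite memv_cap mem_supp_space subset0 -cards_eq0 -wtE wt_eq0 !inE.
by rewrite andbC; case: eqP => // ->; rewrite mem0v.
Qed.

Lemma dim_dual C : \dim (dual C) = (n - \dim C)%N.
Proof.
have := card_dual C; rewrite !card_vspace -expnD => /eqP.
rewrite eqn_exp2l ?card_field_gt1 // => /eqP dn.
exact: (canRL (addKn _) dn).
Qed.

Lemma dim_le C : (\dim C <= n)%N.
Proof. by have := dimvS (subvf C); rewrite dimvf /= /dim /= mul1n. Qed.

Lemma card_setC_ord (S : {set 'I_n}) : #|~: S| = (n - #|S|)%N.
Proof. by rewrite cardsCs setCK card_ord. Qed.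

Lemma card_supersets (S : {set 'I_n}) t : (t <= n)%N ->
  #|[set T : {set 'I_n} | (#|T| == t) && (S \subset T)]| = 'C(n - #|S|, n - t).
Proof.
move=> tn; rewrite -card_setC_ord -cards_draws.
rewrite -(card_imset _ (can_inj (@setCK _))); apply: eq_card => T.
rewrite !inE; apply/imsetP/andP => [[A]|[TS /eqP Tt]].
  rewrite inE => /andP [/eqP At SA] ->; rewrite setCS SA.
  by rewrite card_setC_ord At.
exists (~: T); rewrite ?setCK // inE subsetC TS andbT.
by rewrite card_setC_ord Tt subKn.
Qed.

Lemma card_subsets_compl (S : {set 'I_n}) t :
  #|[set T : {set 'I_n} | (#|T| == t) && (S \subset ~: T)]| = 'C(n - #|S|, t).
Proof.
rewrite -card_setC_ord -cards_draws; apply: eq_card => T.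
by rewrite !inE subsetC andbC.
Qed.

(** Both sums over sets are exchanged with sums over words: the sets [T] of size [t] outside which
    [c] agrees with [v] are the supersets of the support of [v - c], and those on which [h] vanishes
    are the [t]-subsets of its zeros. *)
Lemma binomial_moment C v t : (t <= n)%N ->
  (\sum_(c in C) 'C(n - hdist v c, n - t))%:R * ((q%:R - 1) * #|dual C|%:R) =
  (q ^ t)%:R * \sum_(h in dual C) psi (dotp h v) * 'C(n - wt h, t)%:R :> rat.
Proof.
move=> tn.
transitivity (\sum_(T : {set 'I_n} | #|T| == t)
  (#|[set c in C | supp (v - c) \subset T]|%:R * ((q%:R - 1) * #|dual C|%:R)) : rat).
  rewrite -mulr_suml -natr_sum; congr (_%:R * _).
  under [RHS]eq_bigr => T _ do rewrite -sum1_card.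
  under [RHS]eq_bigr => T _ do rewrite (eq_bigl _ _ (in_set _)) big_mkcondr.
  rewrite exchange_big /=; apply: eq_bigr => c _.
  rewrite -big_mkcondr /= hdistE -card_supersets // -sum1_card.
  by apply: eq_bigl => T; rewrite inE.
transitivity (\sum_(T : {set 'I_n} | #|T| == t) ((q ^ t)%:R *
  \sum_(h in dual C | supp h \subset ~: T) psi (dotp h v)) : rat).
  by apply: eq_bigr => T /eqP <-; rewrite agree_outside_sum.
rewrite -mulr_sumr; congr (_ * _).
under eq_bigr => T _ do rewrite big_mkcondr.
rewrite exchange_big /=; apply: eq_bigr => h _.
rewrite -big_mkcondr /= sumr_const mulr_natr; congr (_ *+ _).
rewrite -card_subsets_compl; apply: eq_card => T.
by rewrite inE unfold_in.
Qed.

Lemma sum_weight_count C (R : nmodType) (f : nat -> R) :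
  \sum_(c in C) f (wt c) = \sum_(j < n.+1) f j *+ weight_count j C.
Proof.
rewrite (partition_big (fun c => inord (wt c) : 'I_n.+1) predT) //=.
apply: eq_bigr => j _; rewrite (eq_bigr (fun=> f j)); last first.
  by move=> c /andP [_ /eqP <-]; rewrite inordK // ltnS wt_le.
rewrite sumr_const; congr (_ *+ _); apply: eq_card => c.
by rewrite !inE unfold_in -val_eqE /= inordK // ltnS wt_le.
Qed.

Lemma sum_dist_count C v (R : nmodType) (f : nat -> R) :
  \sum_(c in C) f (hdist v c) = \sum_(j < n.+1) f j *+ dist_count j v C.
Proof.
have hle c : (hdist v c < n.+1)%N by rewrite hdistE ltnS wt_le.
rewrite (partition_big (fun c => inord (hdist v c) : 'I_n.+1) predT) //=.
apply: eq_bigr => j _; rewrite (eq_bigr (fun=> f j)); last first.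
  by move=> c /andP [_ /eqP <-]; rewrite inordK.
rewrite sumr_const; congr (_ *+ _); apply: eq_card => c.
by rewrite !inE unfold_in -val_eqE /= inordK.
Qed.

Lemma weight_moment C t : (t <= n)%N ->
  ((\sum_(j < n.+1) weight_count j C * 'C(n - j, n - t)) * #|dual C| =
   q ^ t * \sum_(j < n.+1) weight_count j (dual C) * 'C(n - j, t))%N.
Proof.
move=> tn; have := binomial_moment C 0 tn.
under [X in _ = _ * X]eq_bigr => h _ do rewrite dotp0r psi0.
rewrite -mulr_sumr -natr_sum mulrCA [RHS]mulrCA.
move/(mulfI (lt0r_neq0 psi0_gt0))/eqP; rewrite -!natrM eqr_nat => /eqP.
have -> : (\sum_(c in C) 'C(n - hdist 0 c, n - t) =
           \sum_(c in C) 'C(n - wt c, n - t))%N.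
  apply: eq_bigr => c _; rewrite hdistE sub0r wtE -scaleN1r.
  by rewrite suppZ // oppr_eq0 oner_eq0.
rewrite (sum_weight_count C (fun j => 'C(n - j, n - t))).
rewrite (sum_weight_count (dual C) (fun j => 'C(n - j, t))).
have mulE (a b : nat) : a *+ b = (b * a)%N by rewrite -mulr_natr natn mulrC.
under eq_bigr => j _ do rewrite mulE.
by under [in RHS]eq_bigr => j _ do rewrite mulE.
Qed.

(** At each coordinate the entries of [D] are all zero or equidistributed, so their [psi]-sum is
    nonnegative. A zero entry contributes q - 1 and a nonzero one -1, which bounds the average
    weight. *)
Lemma plotkin_sum D T : (D <= supp_space F T)%VS ->
  (q * \sum_(h in D) wt h <= #|T| * (q - 1) * #|D|)%N.
Proof.
move=> /subvP DT.
have : 0 <= \sum_(i in T) \sum_(h in D) psi (h 0 i) :> rat.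
  apply: sumr_ge0 => i _; rewrite (eq_bigr (fun h => psi (0 + dotp h (delta_mx 0 i)))); last first.
    by move=> h _; rewrite dotp_delta add0r.
  rewrite psi_sum; case: ifP => // _.
  by rewrite mulr_ge0 ?ler0n // psi0 ltW ?psi0_gt0.
rewrite exchange_big /=.
rewrite (eq_bigr (fun h => (#|T| * (q - 1))%:R - (q * wt h)%:R)); last first.
  move=> h hD; have hT : supp h \subset T by rewrite -mem_supp_space DT.
  rewrite (big_setID (supp h)) /= (setIidPr hT).
  rewrite (eq_bigr (fun=> -1)); last by move=> i; rewrite inE /psi => /negbTE ->.
  rewrite sumr_const (eq_bigr (fun=> q%:R - 1)); last first.
    by move=> i; rewrite !inE negbK /psi => /andP [-> _].
  rewrite sumr_const cardsD (setIidPr hT) -wtE.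
  have wT : (wt h <= #|T|)%N by exact: subset_leq_card.
  rewrite -[(-1) *+ _]mulr_natr -[(q%:R - 1) *+ _]mulr_natr natrB // !natrM natrB ?(ltnW (card_field_gt1 F)) //.
  by ring.
rewrite sumrB sumr_const -mulrnA -natr_sum subr_ge0 ler_nat.
by rewrite -big_distrr.
Qed.

End Moments.

(** * Covering radius, uniform packing and weights *)

Section Distances.

Lemma bigminn_le (I : finType) (P : pred I) (f : I -> nat) x0 j :
  P j -> (\big[minn/x0]_(i | P i) f i <= f j)%N.
Proof.
move=> Pj; elim: (index_enum I) (mem_index_enum j) => [//|i s IHs].
rewrite inE big_cons => /predU1P [<-|/IHs le_s]; first by rewrite Pj geq_minl.
by case: (P i) => //; apply: leq_trans (geq_minr _ _) le_s.
Qed.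

Lemma bigminn_attained (I : finType) (P : pred I) (f : I -> nat) x0 :
  \big[minn/x0]_(i | P i) f i = x0 \/
  exists2 i, P i & \big[minn/x0]_(i | P i) f i = f i.
Proof.
elim/big_ind: _ => [|x y Hx Hy|i Pi]; first by left.
  by rewrite /minn; case: ifP.
by right; exists i.
Qed.

Variables (F : finFieldType) (n : nat).
Implicit Types (x y u v h c : 'rV[F]_n) (T : {set 'I_n}) (C D K : {vspace 'rV[F]_n}).
Local Notation q := #|F|.

Lemma min_dist_le C c : c \in C -> c != 0 -> (min_dist C <= wt c)%N.
Proof.
move=> cC c0; rewrite -[c]subr0 -hdistE.
apply: (@bigminn_le _ (fun p : 'rV[F]_n * 'rV[F]_n =>
  [&& p.1 \in C, p.2 \in C & p.1 != p.2]) (fun p => hdist p.1 p.2) n.+1 (c, 0)).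
by rewrite /= cC mem0v.
Qed.

Lemma min_dist_attained C : (min_dist C <= n)%N ->
  exists c, [/\ c \in C, c != 0 & wt c = min_dist C].
Proof.
move=> le_n; case: (bigminn_attained
  (fun p : 'rV[F]_n * 'rV[F]_n => [&& p.1 \in C, p.2 \in C & p.1 != p.2])
  (fun p => hdist p.1 p.2) n.+1) => [H|[p /and3P [p1 p2 p12] H]].
  by move: le_n; rewrite /min_dist H ltnn.
by exists (p.1 - p.2); rewrite rpredB // subr_eq0 p12 -hdistE /min_dist H.
Qed.

Lemma min_distP C d :
  (exists c, [/\ c \in C, c != 0 & wt c = d]) ->
  (forall c, c \in C -> c != 0 -> (d <= wt c)%N) -> min_dist C = d.
Proof.
move=> [c [cC c0 cd]] H; apply/eqP; rewrite eqn_leq -{1}cd min_dist_le //=.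
have [|c' [c'C c'0 <-]] := min_dist_attained (C := C); last exact: H.
by apply: leq_trans (min_dist_le cC c0) (wt_le c).
Qed.

Lemma min_dist_gt0 C : (0 < min_dist C)%N.
Proof.
have [|gt_n] := leqP (min_dist C) n; last exact: leq_ltn_trans gt_n.
by case/min_dist_attained => c [_ c0 <-]; rewrite wt_gt0.
Qed.

Lemma dist_code_le C v c : c \in C -> (dist_code v C <= hdist v c)%N.
Proof. exact: (bigminn_le (I := 'rV[F]_n)). Qed.

Lemma dist_code_attained C v : exists2 c, c \in C & hdist v c = dist_code v C.
Proof.
have [H|[c cC H]] := bigminn_attained (fun c => c \in C) (hdist v) n.
  exists 0; rewrite ?mem0v //; apply/eqP; rewrite eqn_leq.
  by rewrite dist_code_le ?mem0v // andbT /dist_code H hdistE wt_le.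
by exists c.
Qed.

Lemma weight_count0 C : weight_count 0 C = 1%N.
Proof.
rewrite /weight_count (@eq_card _ _ (pred1 (0 : 'rV[F]_n))) ?card1 // => c.
by rewrite !inE wt_eq0 andbC; case: eqP => // ->; rewrite mem0v.
Qed.

Lemma weight_count_eq0 C j :
  (0 < j)%N -> (forall c, c \in C -> c != 0 -> wt c != j) -> weight_count j C = 0%N.
Proof.
move=> j0 H; apply/eqP; rewrite cards_eq0; apply/set0Pn => -[c]; rewrite inE.
move=> /andP [cC /eqP cj]; by have := H c cC; rewrite -wt_gt0 cj j0 eqxx => /(_ isT).
Qed.

Lemma weight_count_small C j : (0 < j < min_dist C)%N -> weight_count j C = 0%N.
Proof.
move=> /andP [j0 jd]; apply: weight_count_eq0 => // c cC c0.
by have := min_dist_le cC c0; apply: contraTneq => ->; rewrite -ltnNge.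
Qed.

Lemma coversP C R :
  reflect (forall v, exists2 T : {set 'I_n}, (#|T| <= R)%N &
     forall h, h \in dual C -> supp h \subset ~: T -> dotp h v = 0) (covers C R).
Proof.
apply: (iffP forallP) => H v.
  have /existsP [c /andP [cC cR]] := H v.
  exists (supp (v - c)); first by rewrite -wtE -hdistE.
  by apply/coset_supp_dual; exists c.
have [T TR /coset_supp_dual [c cC cT]] := H v; apply/existsP; exists c.
by rewrite cC hdistE (leq_trans (subset_leq_card cT)).
Qed.

Lemma covers_mono C r s : (r <= s)%N -> covers C r -> covers C s.
Proof.
move=> rs /forallP H; apply/forallP => v; have /existsP [c /andP [cC cr]] := H v.
by apply/existsP; exists c; rewrite cC (leq_trans cr).
Qed.

Lemma covering_radius_le C r : covers C r -> (covering_radius C <= r)%N.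
Proof. by rewrite /covering_radius; case: ex_minnP => m _; apply. Qed.

Lemma covering_radius_gt C r : ~~ covers C r -> (r < covering_radius C)%N.
Proof.
rewrite /covering_radius; case: ex_minnP => m Cm _; apply: contraR.
by rewrite -leqNgt => /covers_mono; apply.
Qed.

Lemma covering_radiusP C r :
  covers C r.+1 -> ~~ covers C r -> covering_radius C = r.+1.
Proof.
move=> /covering_radius_le le1 /covering_radius_gt gt1.
by apply/eqP; rewrite eqn_leq le1 gt1.
Qed.

Lemma covering_radius_len C : (covering_radius C <= n)%N.
Proof.
apply: covering_radius_le; apply/forallP => v; apply/existsP; exists 0.
by rewrite mem0v hdistE wt_le.
Qed.

End Distances.

(** * Annihilator polynomials, Krawtchouk polynomials and uniform packing *)

Section UniformlyPacked.

Lemma mulr_binS (R : numFieldType) (x t : nat) :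
  t.+1%:R * 'C(x, t.+1)%:R = (x%:R - t%:R) * 'C(x, t)%:R :> R.
Proof.
have [tx|xt] := leqP t x; first by rewrite -natrM mul_bin_left natrM natrB.
by rewrite !bin_small ?mulr0 // ltnW.
Qed.

(** The binomial basis is the one in which a polynomial in the number of zeros pairs with the
    binomial moments. The induction uses (x - a) C(x,t) = (t+1) C(x,t+1) + (t-a) C(x,t). *)
Lemma prod_binomial_basis (s : seq rat) : exists g : nat -> rat, forall x : nat,
  \prod_(a <- s) (x%:R - a) = \sum_(t < (size s).+1) g t * 'C(x, t)%:R.
Proof.
elim: s => [|a s [g IHs]].
  by exists (fun=> 1) => x; rewrite big_nil big_ord1 bin0 mulr1.
exists (fun t => (if t is u.+1 then t%:R * g u else 0) +
                 (if (t <= size s)%N then g t * (t%:R - a) else 0)) => x.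
rewrite big_cons IHs; under [RHS]eq_bigr => t _ do rewrite mulrDl.
rewrite big_split /= [X in _ = X + _]big_ord_recl [X in _ = _ + X]big_ord_recr /=.
rewrite mul0r add0r ltnn mul0r addr0 mulr_sumr -big_split /=; apply: eq_bigr => t _.
rewrite -ltnS ltn_ord /bump /= add1n.
have -> : t.+1%:R * g t * 'C(x, t.+1)%:R = g t * (t.+1%:R * 'C(x, t.+1)%:R) :> rat by ring.
by rewrite mulr_binS; ring.
Qed.

Variables (F : finFieldType) (n : nat).
Implicit Types (x y u v h c : 'rV[F]_n) (T : {set 'I_n}) (C D K : {vspace 'rV[F]_n}).
Local Notation q := #|F|.

(** The polynomial [P] vanishes at the number of zeros of every nonzero dual word, so the
    combination of moments with its binomial coefficients retains only [h = 0]. Its degree is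
    [size W], and a moment of order [t] sees no codeword at distance more than [t]; hence the range
    of [j]. *)
Lemma delsarte_identity C (W : seq nat) : (size W <= n)%N -> 0%N \notin W ->
  (forall h, h \in dual C -> h != 0 -> wt h \in W) ->
  exists beta : nat -> rat, forall v,
    \sum_(j < (size W).+1) beta j * (dist_count j v C)%:R = 1.
Proof.
move=> Wn W0 HW; pose s := [seq (n - w)%:R : rat | w <- W].
have [g Hg] := prod_binomial_basis s; rewrite size_map in Hg.
pose P (x : nat) : rat := \prod_(a <- s) (x%:R - a).
have Pn : P n != 0.
  rewrite /P prodf_seq_neq0; apply/allP => a /mapP [w wW ->] /=.
  rewrite subr_eq0 eqr_nat; apply: contraNneq W0 => nw.
  suff -> : 0%N = w by [].
  (* The truncated [n - w] also equals [n] when [n = 0], but then [size W <= n] leaves no [w]. *)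
  by case: W Wn wW {HW s Hg P} => // w' W'; case: n nw => //; lia.
have q0 : (q%:R : rat) != 0 by rewrite pnatr_eq0 -lt0n (ltnW (card_field_gt1 F)).
pose b j := (\sum_(t < (size W).+1) g t * (#|dual C|%:R / q%:R ^+ t) *
               'C(n - j, n - t)%:R) / P n.
exists b => v.
pose M t : rat := \sum_(c in C) 'C(n - hdist v c, n - t)%:R.
have E : \sum_(t < (size W).+1) g t * ((#|dual C|%:R / q%:R ^+ t) * M t) = P n.
  apply: (mulfI (lt0r_neq0 (psi0_gt0 F))); rewrite mulr_sumr.
  transitivity (\sum_(t < (size W).+1) \sum_(h in dual C)
      psi (dotp h v) * (g t * 'C(n - wt h, t)%:R)).
    apply: eq_bigr => t _; have tn : (t <= n)%N by rewrite -ltnS (leq_trans (ltn_ord t)).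
    have := binomial_moment C v tn; rewrite natr_sum -/(M t) => H.
    have -> : (q%:R - 1) * (g t * (#|dual C|%:R / q%:R ^+ t * M t)) =
      g t / q%:R ^+ t * (M t * ((q%:R - 1) * #|dual C|%:R)) by ring.
    rewrite H natrX mulrA divfK ?expf_neq0 // mulr_sumr.
    by apply: eq_bigr => h _; ring.
  rewrite exchange_big /=; under eq_bigr => h _ do rewrite -mulr_sumr -Hg.
  rewrite (bigD1 0) ?mem0v //= dotp0l psi0 wt0 subn0 [X in _ + X]big1 ?addr0 //.
  move=> h /andP [hC h0]; rewrite (_ : \prod_(a <- s) _ = 0) ?mulr0 //.
  apply/eqP; rewrite prodf_seq_eq0; apply/hasP; exists (n - wt h)%:R.
    by apply/mapP; exists (wt h); rewrite ?HW.
  by rewrite /= subrr.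
transitivity (\sum_(j < n.+1) b j * (dist_count j v C)%:R).
  rewrite (big_ord_widen n.+1 (fun j => b j * (dist_count j v C)%:R)) ?ltnS // big_mkcond.
  apply: eq_bigr => j _; case: ltnP => // sj; rewrite /b big1 ?mul0r // => t _.
  by rewrite bin_small ?mulr0 //; have := ltn_ord t; have := ltn_ord j; lia.
apply: (mulIf Pn); rewrite mul1r -[RHS]E mulr_suml.
under eq_bigr => j _ do rewrite /b mulrAC divfK // mulr_suml.
rewrite exchange_big /=; apply: eq_bigr => t _.
rewrite /M (sum_dist_count C v (fun j => 'C(n - j, n - t)%:R : rat)) !mulr_sumr.
by apply: eq_bigr => j _; rewrite -mulr_natr; ring.
Qed.

(** A sum equal to 1 has a nonzero term, hence a codeword at distance at most [size W] from [v]. *)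
Lemma delsarte_covers C (W : seq nat) : (size W <= n)%N -> 0%N \notin W ->
  (forall h, h \in dual C -> h != 0 -> wt h \in W) -> covers C (size W).
Proof.
move=> Wn W0 HW; have [b Hb] := delsarte_identity Wn W0 HW.
apply/forallP => v; apply/existsP; have := Hb v.
case: (pickP (fun c => (c \in C) && (hdist v c <= size W)%N)) => [c|H]; first by exists c.
rewrite big1 => [/eqP|j _]; first by rewrite eq_sym oner_eq0.
rewrite (_ : dist_count j v C = 0%N) ?mulr0 //; apply/eqP; rewrite cards_eq0.
apply/set0Pn => -[c]; rewrite inE => /andP [cC /eqP cj].
by have := H c; rewrite cC cj -ltnS ltn_ord.
Qed.

Lemma UPWS_of_dual_weights C (W : seq nat) : (size W <= n)%N -> 0%N \notin W ->
  (forall h, h \in dual C -> h != 0 -> wt h \in W) ->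
  covering_radius C = size W -> UPWS C.
Proof.
move=> Wn W0 HW; have [b Hb] := delsarte_identity Wn W0 HW; move=> R.
exists (fun j => b j) => v; rewrite -[RHS](Hb v).
by rewrite R.
Qed.

Lemma bin_poly_compl t : exists2 p : {poly rat}, (size p <= t.+1)%N &
  forall w, (w <= n)%N -> p.[w%:R] = 'C(n - w, t)%:R.
Proof.
elim: t => [|t [p sp Hp]].
  by exists 1 => [|w _]; rewrite ?size_poly1 // hornerE bin0.
exists ((t.+1%:R)^-1 *: (((n%:R - t%:R)%:P - 'X) * p)).
  apply: leq_trans (size_scale_leq _ _) _; apply: leq_trans (size_polyMleq _ _) _.
  have : (size ((n%:R - t%:R)%:P - 'X : {poly rat})%R <= 2)%N.
    apply: leq_trans (size_polyD _ _) _; rewrite geq_max size_polyN size_polyX.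
    by rewrite (leq_trans (size_polyC_leq1 _)).
  by move: sp; lia.
move=> w wn; rewrite hornerZ hornerM hornerD hornerN hornerC hornerX Hp //.
apply: (mulfI (_ : (t.+1%:R : rat) != 0)); first by rewrite pnatr_eq0.
by rewrite mulr_binS natrB // mulVKf ?pnatr_eq0 //; ring.
Qed.

(** The binomial moment of the zero code, whose dual is the whole space. The inner sum is q - 1
    times the Krawtchouk polynomial of degree [j] at [wt h]; over all [t] these equations form a
    triangular system. *)
Lemma krawtchouk_sum h t : (t <= n)%N ->
  \sum_(j < n.+1) 'C(n - j, n - t)%:R * (\sum_(e | wt e == j) psi (dotp h e)) =
  (q%:R - 1) * (q ^ t)%:R * 'C(n - wt h, t)%:R :> rat.
Proof.
move=> tn; have := binomial_moment 0%VS h (leq_subr t n).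
rewrite (subKn tn) (eq_bigl (fun c => c == 0)) => [|c]; last by rewrite memv0.
rewrite big_pred1_eq hdistE subr0.
have d0 : dual 0%VS = fullv :> {vspace 'rV[F]_n}.
  apply/vspaceP => x; rewrite memvf; apply/dualP => c; rewrite memv0 => /eqP ->.
  exact: dotp0r.
have := card_dual (0%VS : {vspace 'rV[F]_n}).
rewrite (_ : #|_| = 1%N) ?mul1n => [->|]; last first.
  by rewrite (@eq_card _ _ (pred1 (0 : 'rV[F]_n))) ?card1 // => x; rewrite memv0.
rewrite d0 -[in (q ^ n)%:R](subnKC tn) expnD natrM => H.
have qt : ((q ^ (n - t))%:R : rat) != 0.
  by rewrite pnatr_eq0 -lt0n expn_gt0 (ltnW (card_field_gt1 F)).
apply: (mulfI qt); rewrite [RHS]mulrC -!mulrA.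
transitivity ((q ^ (n - t))%:R *
  \sum_(h0 in (fullv : {vspace 'rV[F]_n})) psi (dotp h0 h) * 'C(n - wt h0, n - t)%:R : rat);
  last by rewrite -H; ring.
congr (_ * _); rewrite [RHS](partition_big (fun c => inord (wt c) : 'I_n.+1) predT) //=.
apply: eq_bigr => j _; rewrite mulr_sumr; apply: eq_big => [e|e /eqP <-].
  by rewrite memvf /= -val_eqE /= inordK // ltnS wt_le.
by rewrite dotpC mulrC.
Qed.

(** Strong induction solves the triangular system of [krawtchouk_sum]. Only the degree bound matters
    later, not the explicit polynomial. *)
Lemma krawtchouk_poly j : (j <= n)%N -> exists2 p : {poly rat}, (size p <= j.+1)%N &
  forall h, \sum_(e | wt e == j) psi (dotp h e) = p.[(wt h)%:R].
Proof.
elim/ltn_ind: j => j IHj jn.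
have /fin_all_exists2 [p sp Hp] : forall i : 'I_j, exists2 p : {poly rat}, (size p <= i.+1)%N &
  forall h, \sum_(e | wt e == i) psi (dotp h e) = p.[(wt h)%:R].
  by move=> i; apply: IHj => //; apply: leq_trans jn; apply: ltnW.
have [b sb Hb] := bin_poly_compl j.
exists (((q%:R - 1) * (q ^ j)%:R) *: b - \sum_(i < j) 'C(n - i, n - j)%:R *: p i).
  apply: leq_trans (size_polyD _ _) _; rewrite geq_max size_polyN.
  rewrite (leq_trans (size_scale_leq _ _) sb) /=.
  apply: leq_trans (size_sum _ _ _) _; apply/bigmax_leqP => i _.
  apply: leq_trans (size_scale_leq _ _) _; apply: leq_trans (sp i) _.
  by rewrite ltnS ltnW.
move=> h; rewrite hornerD hornerN hornerZ Hb ?wt_le // -krawtchouk_sum //.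
rewrite horner_sum; apply/eqP; rewrite eq_sym subr_eq; apply/eqP.
have jn1 : (j < n.+1)%N by [].
rewrite (bigID (fun i : 'I_n.+1 => i < j)%N) /= addrC; congr (_ + _).
  rewrite (bigD1 (Ordinal jn1)) /= ?ltnn // binn mul1r [X in _ + X]big1 ?addr0 //.
  move=> i /andP [ij iNj]; rewrite bin_small ?mul0r //.
  by move: ij iNj; have := ltn_ord i; rewrite -val_eqE /=; lia.
rewrite -(big_ord_widen n.+1 (fun i => 'C(n - i, n - j)%:R *
   \sum_(e : 'rV[F]_n | wt e == i) psi (dotp h e) : rat) (ltnW jn1)).
by apply: eq_bigr => i _; rewrite hornerZ Hp.
Qed.

(** Multiply the packing identity by [psi (dotp h v)] with [h] in the dual and sum over [v]. Writing
    [v] as a codeword plus an error [e] leaves only [dotp h e], so the total is [#|C|] times a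
    polynomial [Q] of degree at most R at [wt h]. The total is zero for [h != 0], which gives [Q]
    more than R roots; but it is positive for [h = 0]. *)
Lemma not_UPWS C (W : seq nat) : uniq W -> 0%N \notin W ->
  (covering_radius C < size W)%N ->
  (forall w, w \in W -> exists2 h, h \in dual C & wt h = w) -> ~ UPWS C.
Proof.
move=> uW W0 RW HW [b Hb]; set R := covering_radius C in RW b Hb *.
have Rn : (R <= n)%N := covering_radius_len C.
have /fin_all_exists2 [p sp Hp] : forall i : 'I_R.+1, exists2 p : {poly rat}, (size p <= i.+1)%N &
  forall h, \sum_(e | wt e == i) psi (dotp h e) = p.[(wt h)%:R].
  by move=> i; apply: krawtchouk_poly; apply: leq_trans Rn; rewrite -ltnS.
pose Q := \sum_(j < R.+1) b j *: p j.
have sQ : (size Q <= R.+1)%N.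
  apply: leq_trans (size_sum _ _ _) _; apply/bigmax_leqP => i _.
  apply: leq_trans (size_scale_leq _ _) _; apply: leq_trans (sp i) _.
  by rewrite ltnS -ltnS.
have E h : h \in dual C -> #|C|%:R * Q.[(wt h)%:R] = \sum_v psi (dotp h v).
  move=> /dualP hC; under [RHS]eq_bigr => v _ do rewrite -[psi _]mulr1 -(Hb v) mulr_sumr.
  rewrite exchange_big /= horner_sum mulr_sumr; apply: eq_bigr => j _.
  rewrite hornerZ -Hp; transitivity
    (b j * \sum_v \sum_(c in C | hdist v c == j) psi (dotp h v)); last first.
    rewrite mulr_sumr; apply: eq_bigr => v _.
    rewrite sumr_const mulrCA mulr_natr; congr (_ * (_ *+ _)).
    by apply: eq_card => c; rewrite [RHS]inE.
  rewrite mulrCA; congr (_ * _); under [RHS]eq_bigr => v _ do rewrite big_mkcondr.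
  rewrite exchange_big /= mulr_natl -sumr_const; apply: eq_bigr => c cC.
  rewrite -big_mkcond /= (reindex_onto (fun v => v - c) (fun e => e + c)) /=; last first.
    by move=> e _; rewrite addrK.
  apply: eq_big => [v|v _]; first by rewrite subrK eqxx andbT hdistE.
  by rewrite dotpDr dotpNr (hC c) // subr0.
have full v : v \in dual fullv = (v == 0).
  apply/dualP/eqP => [H|-> c _]; last exact: dotp0l.
  by apply/rowP => i; rewrite -dotp_delta H ?memvf // mxE.
have sumE h : \sum_v psi (dotp h v) =
    if h == 0 then #|{: 'rV[F]_n}%VS|%:R * (q%:R - 1) else 0 :> rat.
  rewrite -full -psi0 -psi_sum; apply: eq_big => [v|v _]; first by rewrite memvf.
  by rewrite add0r dotpC.
have C0 : (#|C|%:R : rat) != 0 by rewrite pnatr_eq0 -lt0n card_vspace_gt0.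
have Q0 : Q = 0.
  apply/eqP; apply: contraTT RW => Qn0; rewrite -leqNgt -ltnS.
  rewrite -(size_map (fun w => w%:R : rat)).
  apply: leq_trans (max_poly_roots Qn0 _ _) sQ.
    apply/allP => _ /mapP [w wW ->]; rewrite rootE; have [h hC hw] := HW w wW.
    apply/eqP/(mulfI C0); rewrite mulr0 -hw E // sumE ifN //.
    by rewrite -wt_eq0 hw; apply: contraNneq W0 => <-.
  by rewrite map_inj_uniq // => x y /eqP; rewrite eqr_nat => /eqP.
have := E 0 (mem0v _); rewrite Q0 horner0 mulr0 sumE eqxx => /esym/eqP.
rewrite mulf_eq0 pnatr_eq0 eqn0Ngt card_vspace_gt0 /=.
by rewrite (gt_eqF (psi0_gt0 F)).
Qed.

End UniformlyPacked.

(** * The weights d and d + 1 of a near-MDS code *)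

Section NearMDS.
Variables (F : finFieldType) (n : nat).
Implicit Types (C D : {vspace 'rV[F]_n}).
Local Notation q := #|F|.

(** The moment of order [k.-1] is taken on the dual code, whose minimum distance is [k]. On its side
    only words of weight below [k] count, that is, zero; on the side of [C] a word needs at least
    [k.-1] zeros, which leaves the weights 0, n - k and n - k + 1. *)
Lemma near_MDS_weights C k : \dim C = k -> (0 < k)%N -> near_MDS C ->
  (k * weight_count (n - k) C + weight_count (n - k).+1 C =
   'C(n, k.-1) * (q - 1))%N.
Proof.
move=> dimC k0 [dd']; rewrite dimC => dC.
have kn : (k <= n)%N by rewrite -dimC dim_le.
have d'k : min_dist (dual C) = k by move: dd'; rewrite dC; lia.
have d0 := min_dist_gt0 C; rewrite dC in d0.
have := @weight_moment F n (dual C) k.-1 ltac:(lia).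
rewrite dualK [in #|C|](card_vspace) dimC.
rewrite (bigD1 ord0) //= weight_count0 mul1n subn0 [X in (_ + X)%N]big1 ?addn0; last first.
  move=> j j0; have [jk|kj] := ltnP j k.
    by rewrite weight_count_small // d'k jk lt0n andbT.
  by rewrite bin_small ?muln0 //; have := ltn_ord j; lia.
rewrite bin_sub; last by lia.
have dn : (n - k < n.+1)%N by lia.
have d1n : ((n - k).+1 < n.+1)%N by lia.
rewrite (bigD1 ord0) //= weight_count0 mul1n subn0.
rewrite (bigD1 (Ordinal dn)) /=; last by rewrite -val_eqE /= -lt0n.
rewrite (bigD1 (Ordinal d1n)) /=; last by rewrite -!val_eqE /=; lia.
rewrite [X in (_ + (_ + (_ + X)))%N]big1 ?addn0; last first.
  move=> j; rewrite -!val_eqE /= => /andP [/andP [j0 jd] jd1].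
  have [lt_jd|gt_jd] := ltnP j (n - k).
    by rewrite weight_count_small // dC lt_jd lt0n j0.
  by rewrite bin_small ?muln0 //; have := ltn_ord j; lia.
have binP m : (0 < m)%N -> 'C(m, m.-1) = m by case: m => // m _; rewrite binSn.
have -> : (n - (n - k).+1 = k.-1)%N by lia.
rewrite subKn // binP // binn muln1 -[in (q ^ k)%N](prednK k0) expnSr.
have q0 : (0 < q ^ k.-1)%N by rewrite expn_gt0 (ltnW (card_field_gt1 F)).
rewrite mulnCA => /eqP; rewrite eqn_pmul2l // => /eqP; rewrite mulnBr muln1 => ->.
by rewrite addKn mulnC.
Qed.

End NearMDS.

(** * Lifted codes *)

Section ExtensionBasis.
Variables (p : nat) (p_pr : prime p) (L : finFieldType).
Variables (iota : {rmorphism 'F_p -> L}) (m : nat) (cardL : #|L| = (p ^ m)%N).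

(** Any ring morphism from ['F_p] sends [a] to [a%:R]. The vector space structure of [L] given by
    its characteristic therefore has multiplication by [iota a] as scaling, whichever [iota] is
    given. *)
Lemma extension_basis : exists alpha : 'rV[L]_m,
  (forall x : L, exists a : 'cV['F_p]_m, x = (alpha *m map_mx iota a) 0 0) /\
  (forall a : 'cV['F_p]_m, alpha *m map_mx iota a = 0 -> a = 0).
Proof.
have pL : p \in [pchar L] by apply: (rmorph_pchar iota); exact: pchar_Fp.
have iotaE (a : 'F_p) : iota a = (a : nat)%:R.
  by rewrite -[in LHS](natr_Zp a) rmorph_nat.
pose V : vectType 'F_p := pPrimeCharType pL.
have dimV : \dim {:V} = m by rewrite pprimeChar_dimf /= cardL pfactorK.
pose b := vbasis {:V}.
have scaleE (a : 'F_p) (x : V) : a *: x = (iota a * (x : L)) :> L by rewrite iotaE.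
have sumE (c : 'cV['F_p]_m) :
  (\row_(i < m) (b`_i : L) *m map_mx iota c) 0 0 = \sum_(i < m) c i 0 *: b`_i :> V.
  by rewrite mxE; apply: eq_bigr => i _; rewrite !mxE mulrC -scaleE.
exists (\row_(i < m) (b`_i : L)); split => [x|c].
  exists (\col_i coord b (cast_ord (esym dimV) i) (x : V)).
  rewrite sumE {1}(coord_vbasis (memvf (x : V))).
  rewrite (reindex (cast_ord (esym dimV))) /=; last first.
    by exists (cast_ord dimV) => i _; rewrite ?cast_ordK ?cast_ordKV.
  by apply: eq_bigr => i _; rewrite mxE.
move/matrixP/(_ 0 0); rewrite sumE mxE => s0; apply/colP => i; rewrite mxE.
have /freeP/(_ (fun j => c (cast_ord dimV j) 0)) := basis_free (vbasisP {:V}).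
move=> /(_ _ (cast_ord (esym dimV) i)); rewrite cast_ordKV; apply.
rewrite -[RHS]s0 [RHS](reindex (cast_ord dimV)) //=.
by exists (cast_ord (esym dimV)) => j _; rewrite ?cast_ordK ?cast_ordKV.
Qed.

Lemma extension_coords : exists alpha : 'rV[L]_m,
  (forall n (x : 'rV[L]_n), exists X : 'M['F_p]_(m, n), x = alpha *m map_mx iota X) /\
  (forall n (X : 'M['F_p]_(m, n)), alpha *m map_mx iota X = 0 -> X = 0).
Proof.
have [alpha [span_a free_a]] := extension_basis; exists alpha; split => n.
  move=> x; have /fin_all_exists [a Ha] : forall j, exists a : 'cV['F_p]_m,
      x 0 j = (alpha *m map_mx iota a) 0 0 by move=> j; apply: span_a.
  exists (\matrix_(i, j) a j i 0); apply/rowP => j; rewrite Ha !mxE.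
  by apply: eq_bigr => i _; rewrite !mxE.
move=> X X0; apply/matrixP => i j; rewrite [RHS]mxE.
suff /colP/(_ i) : col j X = 0 by rewrite !mxE.
by apply: free_a; rewrite map_col !colE mulmxA X0 mul0mx.
Qed.

End ExtensionBasis.

Section LiftedCode.
Variables (p : nat) (p_pr : prime p) (L : finFieldType).
Variables (iota : {rmorphism 'F_p -> L}) (m : nat) (cardL : #|L| = (p ^ m)%N).
Variable n : nat.
Implicit Types (C : {vspace 'rV['F_p]_n}) (c h : 'rV['F_p]_n) (X Y : 'M['F_p]_(m, n)).

Lemma supp_map c : supp (map_mx iota c) = supp c.
Proof. by apply/setP => j; rewrite !inE mxE fmorph_eq0. Qed.

Lemma wt_map c : wt (map_mx iota c) = wt c.
Proof. by rewrite !wtE supp_map. Qed.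

Lemma mem_lift_map C c : (map_mx iota c \in lift_code iota C) = (c \in C).
Proof.
rewrite -[in RHS](check_code_parity_mx C) /lift_code !mem_check_code.
by rewrite map_trmx -map_mxM map_mx_eq0.
Qed.

(* [lin X] is the combination of the rows of [X] with coefficients a basis of [L]
   over 'F_p. *)
Lemma lift_decomposition : exists lin : 'M['F_p]_(m, n) -> 'rV[L]_n,
  [/\ forall x, exists X, x = lin X, injective lin,
      forall X C, (lin X \in lift_code iota C) = [forall i, row i X \in C],
      forall X, supp (lin X) = \bigcup_i supp (row i X)
    & (forall X Y, X *m Y^T = 0 -> dotp (lin X) (lin Y) = 0) /\
      (forall X h, (dotp (lin X) (map_mx iota h) == 0) = (X *m h^T == 0))].
Proof.
have [alpha [spanA freeA]] := extension_coords p_pr iota cardL.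
have freeE k (X : 'M_(m, k)) : (alpha *m map_mx iota X == 0) = (X == 0).
  apply/eqP/eqP => [/freeA //|->]; first by rewrite map_mx0 mulmx0.
exists (fun X => alpha *m map_mx iota X); split.
- exact: spanA.
- move=> X Y /eqP; rewrite -subr_eq0 -mulmxBr -map_mxB freeE subr_eq0.
  by move/eqP.
- move=> X C; rewrite /lift_code mem_check_code -trmx_eq0 trmx_mul trmxK.
  rewrite map_trmx -mulmxA -map_mxM freeE.
  apply/eqP/forallP => [X0 i|H].
    rewrite -(check_code_parity_mx C) mem_check_code -trmx_eq0 trmx_mul trmxK.
    by rewrite -row_mul X0 row0.
  apply/row_matrixP => i; rewrite row_mul row0; apply/eqP.
  by rewrite -trmx_eq0 trmx_mul trmxK -mem_check_code check_code_parity_mx.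
- move=> X; apply/setP => j; rewrite inE.
  have -> : (alpha *m map_mx iota X) 0 j == 0 = (col j X == 0).
    rewrite -freeE map_col colE mulmxA -colE; apply/eqP/eqP => [Xj|/colP/(_ 0)].
      by apply/colP => i; rewrite mxE ord1 Xj mxE.
    by rewrite !mxE.
  apply/idP/bigcupP => [|[i _]].
    have [/existsP [i Xij] _|] := boolP [exists i, X i j != 0].
      by exists i; rewrite ?inE ?mxE.
    rewrite negb_exists => /forallP H /eqP [].
    by apply/colP => i; rewrite !mxE; apply/eqP/negPn.
  by rewrite inE mxE; apply: contraNN => /eqP/colP/(_ i); rewrite !mxE => ->.
- split=> [X Y XY|X h].
    apply/eqP; rewrite -dotp_mx0 trmx_mul map_trmx -mulmxA (mulmxA (map_mx iota X)).
    by rewrite -map_mxM XY map_mx0 mul0mx mulmx0.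
  by rewrite -dotp_mx0 map_trmx -mulmxA -map_mxM freeE.
Qed.

Lemma dim_lift C : \dim (lift_code iota C) = \dim C.
Proof.
have [lin [lin_surj lin_inj memL _ _]] := lift_decomposition.
have m0 : (0 < m)%N.
  by case: m cardL => //; rewrite expn0 => L1; have := card_field_gt1 L; rewrite L1.
suff : #|lift_code iota C| = (#|C| ^ m)%N.
  rewrite !card_vspace cardL card_Fp // -!expnM => /eqP.
  by rewrite eqn_exp2l ?prime_gt1 // mulnC eqn_pmul2r // => /eqP.
rewrite -[in RHS](card_ord m) -card_ffun_on.
rewrite -(@card_imset _ _ (fun f : {ffun 'I_m -> 'rV['F_p]_n} =>
    lin (\matrix_(i < m) f i))); last first.
  move=> f g /lin_inj /row_matrixP fg; apply/ffunP => i.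
  by have := fg i; rewrite !rowK.
apply: eq_card => x; apply/idP/imsetP => [|[f /ffun_onP fC ->]].
  have [X ->] := lin_surj x; rewrite memL => /forallP XC.
  exists [ffun i => row i X]; first by apply/ffun_onP => i; rewrite ffunE XC.
  by congr lin; apply/row_matrixP => i; rewrite rowK ffunE.
by rewrite memL; apply/forallP => i; rewrite rowK.
Qed.

Lemma dual_lift C : dual (lift_code iota C) = lift_code iota (dual C).
Proof.
have [lin [lin_surj _ memL _ [linD _]]] := lift_decomposition.
apply/esym/eqP; rewrite eqEdim dim_lift !dim_dual dim_lift leqnn andbT.
apply/subvP => x; have [X ->] := lin_surj x; rewrite memL => /forallP XC.
apply/dualP => y; have [Y ->] := lin_surj y; rewrite memL => /forallP YC.
apply: linD; apply/matrixP => i j; rewrite [RHS]mxE.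
rewrite -[RHS](dualP _ _ (XC i) (row j Y) (YC j)) dotpE mxE.
by apply: eq_bigr => k _; rewrite !mxE.
Qed.

Lemma min_dist_lift C : (min_dist C <= n)%N ->
  min_dist (lift_code iota C) = min_dist C.
Proof.
move=> dn; have [c [cC c0 cd]] := min_dist_attained dn.
apply: min_distP => [|x].
  by exists (map_mx iota c); rewrite mem_lift_map map_mx_eq0 wt_map.
have [lin [lin_surj _ memL suppL _]] := lift_decomposition.
have [X ->] := lin_surj x; rewrite memL => /forallP XC.
rewrite -wt_gt0 !wtE suppL => /card_gt0P [j /bigcupP [i _ ij]].
have Xi0 : row i X != 0 by rewrite -wt_gt0 wtE; apply/card_gt0P; exists j.
apply: leq_trans (min_dist_le (XC i) Xi0) _; rewrite wtE; apply: subset_leq_card.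
exact: (bigcup_sup i).
Qed.

Lemma code_params_lift C k d : (d <= n)%N ->
  code_params C k d -> code_params (lift_code iota C) k d.
Proof.
by move=> dn [dimC dC]; split; rewrite ?dim_lift // min_dist_lift dC.
Qed.

Lemma near_MDS_lift C : near_MDS C -> near_MDS (lift_code iota C).
Proof.
move=> [dd dC]; rewrite /near_MDS dual_lift dim_lift !min_dist_lift //.
- by apply: leq_trans (leq_addl _ _) (eq_leq dd).
- by apply: leq_trans (leq_addr _ _) (eq_leq dd).
Qed.

(** Dual words over the base field suffice: if a lifted dual word vanishes on [T], so do all its
    rows. *)
Lemma covers_liftP C R :
  covers (lift_code iota C) R <->
  (forall X, exists2 T : {set 'I_n}, (#|T| <= R)%N &
     forall h, h \in dual C -> supp h \subset ~: T -> X *m h^T = 0).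
Proof.
have [lin [lin_surj _ memL suppL [linD linM]]] := lift_decomposition.
split=> [/coversP H|H]; last apply/coversP.
  move=> X; have [T TR HT] := H (lin X); exists T => // h hC hT.
  by apply/eqP; rewrite -linM dotpC HT ?supp_map // dual_lift mem_lift_map.
move=> x; have [X ->] := lin_surj x; have [T TR HT] := H X; exists T => // h.
have [Y ->] := lin_surj h; rewrite dual_lift memL suppL => /forallP YC /bigcupsP YT.
rewrite dotpC; apply: linD; apply/matrixP => i j; rewrite [RHS]mxE.
have /matrixP/(_ i 0) := HT (row j Y) (YC j) (YT j isT).
rewrite mxE [RHS]mxE mxE => X0; rewrite -[RHS]X0.
by apply: eq_bigr => k _; rewrite !mxE.
Qed.

Lemma lift_union_weight C c1 c2 : (2 <= m)%N -> c1 \in C -> c2 \in C ->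
  exists2 x, x \in lift_code iota C & wt x = #|supp c1 :|: supp c2|.
Proof.
move=> m2 c1C c2C; have [lin [_ _ memL suppL _]] := lift_decomposition.
pose X : 'M['F_p]_(m, n) := \matrix_(i < m) if (i == 0 :> nat)%N then c1 else c2.
exists (lin X); first by rewrite memL; apply/forallP => i; rewrite rowK; case: ifP.
rewrite wtE suppL; apply: eq_card => j; apply/bigcupP/setUP => [[i _]|].
  by rewrite rowK; case: ifP => _; [left|right].
case=> jc; [exists (Ordinal (ltnW m2)) | exists (Ordinal m2)] => //; by rewrite rowK.
Qed.

(** All rows of [x] lie in the subcode supported on its support. If that subcode is a line, they are
    multiples of one nonzero row, which then has the same support as [x]. *)
Lemma lift_weight_line C x :
  (forall T : {set 'I_n}, #|T| = wt x -> (\dim (C :&: supp_space 'F_p T) <= 1)%N) ->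
  x \in lift_code iota C -> x != 0 -> exists2 c, c \in C & wt c = wt x.
Proof.
move=> lineC; have [lin [lin_surj _ memL suppL _]] := lift_decomposition.
have [X xE] := lin_surj x; rewrite {1}xE memL => /forallP XC.
rewrite -wt_gt0 !wtE => /card_gt0P [j]; rewrite {1}xE suppL => /bigcupP [i _ ij].
exists (row i X) => //; rewrite wtE; congr #|pred_of_set _|.
have rowD k : row k X \in (C :&: supp_space 'F_p (supp x))%VS.
  by rewrite memv_cap XC mem_supp_space xE suppL (bigcup_sup k).
have Xi0 : row i X != 0 by rewrite -wt_gt0 wtE; apply/card_gt0P; exists j.
have D_line : (C :&: supp_space 'F_p (supp x) <= <[row i X]>)%VS.
  have : (<[row i X]> <= C :&: supp_space 'F_p (supp x))%VS by rewrite -memvE.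
  by move=> sD; rewrite -(geq_leqif (dimv_leqif_sup sD)) dim_vline Xi0 lineC.
apply/eqP; rewrite eqEsubset xE suppL (bigcup_sup i) //=.
apply/bigcupsP => k _; have /vlineP [a ->] := subvP D_line _ (rowD k).
by apply/suppP => l; rewrite inE negbK !mxE => /eqP ->; rewrite mulr0.
Qed.

End LiftedCode.

(** * Ternary words as lists *)

(** Plain data, on which the enumerations of whole codes below are evaluated by computation; [t2F]
    and [F2t] transfer the results to ['F_3]. *)
Definition trit := option bool.

Definition tadd (a b : trit) : trit :=
  match a, b with
  | None, _ => b
  | _, None => a
  | Some true, Some true => Some false
  | Some false, Some false => Some true
  | _, _ => None
  end.

Definition tneg (a : trit) : trit := if a is Some x then Some (negb x) else None.

Definition tmul (a b : trit) : trit :=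
  match a, b with
  | Some x, Some y => Some (xorb x y)
  | _, _ => None
  end.

Definition tdiff (a b : trit) : bool :=
  match a, b with
  | None, None => false
  | Some x, Some y => xorb x y
  | _, _ => true
  end.

(* [None], [Some false], [Some true] stand for 0, 1, -1. *)
Definition t2F (a : trit) : 'F_3 := if a is Some x then (if x then -1 else 1) else 0.
Definition F2t (x : 'F_3) : trit := if x == 0 then None else Some (x == -1).

Lemma t2FK : cancel t2F F2t. Proof. by case=> [[]|]. Qed.
Lemma F2tK : cancel F2t t2F.
Proof. by case=> [[|[|[|]]]] // lt3; apply: val_inj. Qed.
Lemma t2F_eq0 a : (t2F a == 0) = ~~ isSome a. Proof. by case: a => [[]|]. Qed.
Lemma t2F_add a b : t2F (tadd a b) = t2F a + t2F b.
Proof. by apply: val_inj; case: a => [[]|]; case: b => [[]|]. Qed.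
Lemma t2F_neg a : t2F (tneg a) = - t2F a.
Proof. by apply: val_inj; case: a => [[]|]. Qed.
Lemma t2F_mul a b : t2F (tmul a b) = t2F a * t2F b.
Proof. by apply: val_inj; case: a => [[]|]; case: b => [[]|]. Qed.
Lemma t2F_diff a b : tdiff a b = (t2F a != t2F b).
Proof. by case: a => [[]|]; case: b => [[]|]. Qed.

Definition word := seq trit.

Fixpoint addw (s t : word) : word :=
  match s, t with a :: s', b :: t' => tadd a b :: addw s' t' | _, _ => [::] end.
Definition negw (s : word) : word := map tneg s.
Fixpoint dotw (s t : word) : trit :=
  match s, t with a :: s', b :: t' => tadd (tmul a b) (dotw s' t') | _, _ => None end.
Fixpoint distw (s t : word) : nat :=
  match s, t with a :: s', b :: t' => if tdiff a b then (distw s' t').+1 else distw s' t'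
  | _, _ => 0%N end.
Fixpoint wtw (s : word) : nat :=
  if s is a :: s' then (if a is Some _ then (wtw s').+1 else wtw s') else 0%N.
Fixpoint unionw (s t : word) : nat :=
  match s, t with
  | a :: s', b :: t' => if isSome a || isSome b then (unionw s' t').+1 else unionw s' t'
  | _, _ => 0%N end.

Fixpoint spanw (n : nat) (rows : seq word) : seq word :=
  if rows is r :: rows' then
    let S := spanw n rows' in S ++ map (addw r) S ++ map (addw (negw r)) S
  else [:: nseq n None].

Fixpoint allw (n : nat) : seq word :=
  if n is n'.+1 then
    let S := allw n' in
    map (cons None) S ++ map (cons (Some false)) S ++ map (cons (Some true)) S
  else [:: [::]].

Lemma allwP n s : size s = n -> s \in allw n.
Proof.
elim: n s => [|k IHk] [|a s] //= [sk]; rewrite !mem_cat.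
have inj b : injective (cons b : word -> word) by move=> ? ? [].
case: a => [[]|]; rewrite (mem_map (inj _)) IHk ?orbT //.
Qed.

Section Words.
Variable n : nat.
Implicit Types (x y : 'rV['F_3]_n) (s t : word).

Definition of_word s : 'rV['F_3]_n := \row_i t2F (nth None s i).
Definition to_word x : word := [seq F2t (x 0 i) | i <- enum 'I_n].

Lemma size_to_word x : size (to_word x) = n.
Proof. by rewrite size_map size_enum_ord. Qed.

Lemma nth_to_word x (i : 'I_n) : nth None (to_word x) i = F2t (x 0 i).
Proof. by rewrite (nth_map i) ?size_enum_ord // nth_ord_enum. Qed.

Lemma to_wordK : cancel to_word of_word.
Proof. by move=> x; apply/rowP => i; rewrite mxE nth_to_word F2tK. Qed.

Lemma of_wordK s : size s = n -> to_word (of_word s) = s.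
Proof.
move=> sn; apply: (@eq_from_nth _ None); rewrite size_to_word // => i lt_in.
by rewrite (nth_to_word _ (Ordinal lt_in)) mxE t2FK.
Qed.

Lemma to_word_inj : injective to_word. Proof. exact: can_inj to_wordK. Qed.

Lemma size_addw s t : size (addw s t) = minn (size s) (size t).
Proof. by elim: s t => [|a s IHs] [|b t] //=; rewrite IHs minnSS. Qed.

Lemma nth_addw s t i : size s = size t ->
  nth None (addw s t) i = tadd (nth None s i) (nth None t i).
Proof. by elim: s t i => [|a s IHs] [|b t] [|i] //= [st]; rewrite IHs. Qed.

Lemma of_word_add s t : size s = size t -> of_word (addw s t) = of_word s + of_word t.
Proof. by move=> st; apply/rowP => i; rewrite !mxE nth_addw // t2F_add. Qed.

Lemma of_word_neg s : of_word (negw s) = - of_word s.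
Proof.
apply/rowP => i; rewrite !mxE -t2F_neg; have [si|si] := ltnP i (size s).
  by rewrite (nth_map None).
by rewrite !nth_default // size_map.
Qed.

Lemma of_word0 : of_word (nseq n None) = 0.
Proof. by apply/rowP => i; rewrite !mxE nth_nseq if_same. Qed.

Lemma to_word0 : to_word 0 = nseq n None.
Proof. by rewrite -of_word0 of_wordK ?size_nseq. Qed.

Definition gen_mx (rows : seq word) : 'M['F_3]_(size rows, n) :=
  \matrix_(i < size rows) of_word (nth [::] rows i).
Definition code rows : {vspace 'rV['F_3]_n} := gen_code (gen_mx rows).

Lemma code_nil x : (x \in code [::]) = (x == 0).
Proof.
rewrite mem_gen_code; apply/submxP/eqP => [[u ->]|->]; last by exists 0; rewrite mul0mx.
by apply/rowP => i; rewrite !mxE big_ord0.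
Qed.

Lemma code_cons r rows x :
  x \in code (r :: rows) <-> exists a : 'F_3, x - a *: of_word r \in code rows.
Proof.
have rowE (i : 'I_(1 + size rows)) : of_word (nth [::] (r :: rows) i) =
    row i (col_mx (of_word r) (gen_mx rows)).
  case: (split_ordP i) => j ->; first by rewrite rowKu ord1 row_id.
  by rewrite rowKd rowK.
have genE : gen_mx (r :: rows) = col_mx (of_word r) (gen_mx rows).
  by apply/row_matrixP => i; rewrite [LHS]rowK rowE.
have -> : (x \in code (r :: rows)) = (x <= col_mx (of_word r) (gen_mx rows))%MS.
  by rewrite mem_gen_code genE.
rewrite -addsmxE; split=> [/sub_addsmxP [[u v] /= ->]|[a]].
  exists (u 0 0); rewrite [u in u *m _]mx11_scalar mul_scalar_mx addrC addKr.
  by rewrite mem_gen_code submxMl.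
rewrite mem_gen_code => xa; rewrite -(subrK (a *: of_word r) x) addrC.
by apply: addmx_sub_adds xa; apply: scalemx_sub.
Qed.

Lemma F3_cases (a : 'F_3) : [\/ a = 0, a = 1 | a = -1].
Proof.
by case: a => [[|[|[|]]]] // lt3; [constructor 1|constructor 2|constructor 3]; apply: val_inj.
Qed.

Definition wf_rows (rows : seq word) := all (fun r => size r == n) rows.

Lemma size_spanw rows s : wf_rows rows -> s \in spanw n rows -> size s = n.
Proof.
elim: rows s => [|r rows IHr] s /=; first by rewrite inE => _ /eqP ->; rewrite size_nseq.
move=> /andP [/eqP rn wf]; rewrite !mem_cat => /or3P [/(IHr _ wf) //||].
  by case/mapP => t /(IHr _ wf) tn ->; rewrite size_addw tn rn minnn.
by case/mapP => t /(IHr _ wf) tn ->; rewrite size_addw tn size_map rn minnn.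
Qed.

Lemma codeP rows x : wf_rows rows -> (x \in code rows) = (to_word x \in spanw n rows).
Proof.
elim: rows x => [|r rows IHr] x.
  by rewrite code_nil /= inE -to_word0 (inj_eq to_word_inj).
move=> /andP [/eqP rn wf]; rewrite [spanw _ _]/= !mem_cat.
have add_mem (t : word) : size t = n -> (to_word x \in map (addw t) (spanw n rows)) =
    (x - of_word t \in code rows).
  move=> tn; rewrite IHr //; apply/mapP/idP => [[s sS xs]|xt].
    have sn := size_spanw wf sS.
    by rewrite -(to_wordK x) xs of_word_add ?tn ?sn // addrC addKr of_wordK.
  exists (to_word (x - of_word t)) => //; rewrite -[RHS]of_wordK; last first.
    by rewrite size_addw tn size_to_word minnn.
  by rewrite of_word_add ?tn ?size_to_word // to_wordK subrKC.
rewrite !add_mem ?size_map // of_word_neg -IHr //.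
apply/idP/or3P => [/code_cons [a]|].
  case: (F3_cases a) => ->; rewrite ?scale0r ?scale1r ?scaleN1r ?subr0 => H.
  - by constructor 1.
  - by constructor 2.
  - by constructor 3.
case=> H; apply/code_cons; [exists 0|exists 1|exists (-1)];
by rewrite ?scale0r ?scale1r ?scaleN1r ?subr0.
Qed.

Lemma of_word_wt s : size s = n -> wt (of_word s) = wtw s.
Proof.
move=> sn; have -> : wtw s = count isSome s.
  by elim: {sn} s => [|[a|] s IHs] //=; rewrite IHs.
rewrite -sum1_count (big_nth None) sn big_mkord /wt -sum1_card; apply: eq_bigl => i.
by rewrite inE mxE t2F_eq0 negbK.
Qed.

Lemma wt_to_word x : wt x = wtw (to_word x).
Proof. by rewrite -of_word_wt ?size_to_word // to_wordK. Qed.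

Lemma of_word_dot s t : size s = n -> size t = n ->
  dotp (of_word s) (of_word t) = t2F (dotw s t).
Proof.
move=> sn tn; rewrite dotpE.
under eq_bigr => i _ do rewrite !mxE -t2F_mul.
rewrite -(big_mkord xpredT (fun i => t2F (tmul (nth None s i) (nth None t i)))).
rewrite -[X in index_iota _ X]sn; have {sn tn} st : size s = size t by rewrite sn tn.
elim: s t st => [|a s IHs] [|b t] //= => [_|[st]]; first by rewrite big_geq.
by rewrite big_nat_recl // IHs // -t2F_add.
Qed.

Lemma hdist_to_word x y : hdist x y = distw (to_word x) (to_word y).
Proof.
have -> s t : size s = size t ->
    distw s t = count (fun p => tdiff p.1 p.2) (zip s t).
  by elim: s t => [|a s IHs] [|b t] //= [st]; rewrite IHs //; case: tdiff.
rewrite -sum1_count (big_nth (None, None)) size_zip !size_to_word minnn big_mkord.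
rewrite /hdist -sum1_card; apply: eq_bigl => i.
by rewrite nth_zip ?size_to_word //= !nth_to_word t2F_diff !F2tK inE.
by rewrite !size_to_word.
Qed.

Lemma card_supp_union x y : #|supp x :|: supp y| = unionw (to_word x) (to_word y).
Proof.
have E s t : size s = size t ->
    unionw s t = count (fun p => isSome p.1 || isSome p.2) (zip s t).
  by elim: s t => [|a s IHs] [|b t] //= [st]; rewrite IHs //; case: ifP.
rewrite E ?size_to_word //.
rewrite -sum1_count (big_nth (None, None)) size_zip !size_to_word minnn big_mkord.
rewrite -sum1_card; apply: eq_bigl => i.
rewrite nth_zip ?size_to_word //= !nth_to_word !inE.
by rewrite -[in LHS](F2tK (x 0 i)) -[in LHS](F2tK (y 0 i)) !t2F_eq0 !negbK.
Qed.

Lemma mem_code_rows rows r : r \in rows -> of_word r \in code rows.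
Proof.
move=> /(nthP [::]) [i ilt <-]; rewrite mem_gen_code.
have -> : of_word (nth [::] rows i) = row (Ordinal ilt) (gen_mx rows) by rewrite rowK.
exact: row_sub.
Qed.

Lemma dual_codeP rows x : wf_rows rows ->
  (x \in dual (code rows)) = all (fun r => dotw r (to_word x) == None) rows.
Proof.
move=> /allP wf; have dotE r : r \in rows ->
    (dotp x (of_word r) == 0) = (dotw r (to_word x) == None).
  move=> /wf /eqP rn; rewrite dotpC -{1}(to_wordK x) of_word_dot ?size_to_word //.
  by rewrite t2F_eq0; case: dotw.
rewrite dual_gen_code mem_check_code; apply/eqP/allP => [H r rr|H].
  rewrite -dotE // -dotp_mx0; have /(nthP [::]) [i ilt <-] := rr.
  have -> : of_word (nth [::] rows i) = row (Ordinal ilt) (gen_mx rows) by rewrite rowK.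
  by rewrite -trmx_eq0 trmx_mul trmxK -row_mul H row0.
apply/row_matrixP => i; rewrite row_mul row0 rowK; apply/eqP; rewrite dotp_mx0 dotpC.
by rewrite dotE ?H ?mem_nth.
Qed.

Definition systematic (rows : seq word) :=
  (size rows <= n)%N &&
  all (fun i => all (fun j => nth None (nth [::] rows i) j ==
     if i == j then Some false else None) (iota 0 (size rows))) (iota 0 (size rows)).

Definition first_coords k : 'M['F_3]_(n, k) := \matrix_(i, j) (i == j :> nat)%:R.

Lemma mul_first_coords k x (i : 'I_n) (j : 'I_k) :
  i = j :> nat -> (x *m first_coords k) 0 j = x 0 i.
Proof.
move=> ij; rewrite mxE (bigD1 i) //= mxE ij eqxx mulr1 big1 ?addr0 // => l li.
by rewrite mxE -ij (inj_eq val_inj) (negbTE li) mulr0.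
Qed.

Lemma gen_mx_systematic rows : systematic rows ->
  gen_mx rows *m first_coords (size rows) = 1%:M.
Proof.
case/andP => kn /allP sys; apply/row_matrixP => i; rewrite row_mul rowK.
apply/rowP => j; have jn : (j < n)%N by apply: leq_trans kn.
rewrite (@mul_first_coords _ _ (Ordinal jn)) // !mxE.
have iI : (i : nat) \in iota 0 (size rows) by rewrite mem_iota ltn_ord.
have jI : (j : nat) \in iota 0 (size rows) by rewrite mem_iota ltn_ord.
have /allP/(_ _ jI)/eqP -> := sys _ iI.
by rewrite -(inj_eq val_inj i j); case: eqP.
Qed.

Lemma dim_code rows : systematic rows -> \dim (code rows) = size rows.
Proof.
move=> /gen_mx_systematic sys; rewrite /code /gen_code limg_dim_eq ?dimvf /=.
  by rewrite /dim /= mul1n.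
apply/eqP; rewrite -subv0; apply/subvP => u; rewrite memv_cap memvf memv_ker lfunE /=.
by move/eqP => u0; rewrite -[u]mulmx1 -sys mulmxA u0 mul0mx mem0v.
Qed.

(** Subtracting the codeword that agrees with [v] on the information positions leaves one
    representative per coset, with its free entries on the last positions. *)
Lemma systematic_coset rows v : systematic rows ->
  exists2 c, c \in code rows &
  exists2 y, y \in allw (n - size rows) & to_word (v - c) = nseq (size rows) None ++ y.
Proof.
move=> sys; have GB := gen_mx_systematic sys; have /andP [kn _] := sys.
pose c := v *m first_coords (size rows) *m gen_mx rows.
exists c; first by rewrite mem_gen_code submxMl.
exists (drop (size rows) (to_word (v - c))).
  by apply: allwP; rewrite size_drop size_to_word.
rewrite -[LHS](cat_take_drop (size rows)); congr (_ ++ _).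
apply: (@eq_from_nth _ None).
  by rewrite size_takel ?size_nseq // size_to_word.
rewrite size_takel ?size_to_word // => j jk; rewrite nth_take // nth_nseq jk.
have jn : (j < n)%N by apply: leq_trans kn.
rewrite (nth_to_word _ (Ordinal jn)).
rewrite -(@mul_first_coords _ _ _ (Ordinal jk)) // mulmxBl -mulmxA GB mulmx1 subrr mxE.
by rewrite /F2t eqxx.
Qed.

Lemma dual_code rowsG rowsH : wf_rows rowsG -> wf_rows rowsH ->
  systematic rowsG -> (size rowsG + size rowsH = n)%N ->
  \dim (code rowsH) = size rowsH ->
  all (fun h => all (fun g => dotw g h == None) rowsG) rowsH ->
  dual (code rowsG) = code rowsH.
Proof.
move=> wfG wfH sysG GH dimH orth; apply/esym/eqP; rewrite eqEdim.
rewrite dim_dual dimH dim_code // leq_subLR (eq_leq (esym GH)) andbT.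
apply/subvP => x; rewrite mem_gen_code => /submxP [u ->].
rewrite mulmx_sum_row memv_suml // => i _; apply: memvZ; rewrite rowK.
have ri : nth [::] rowsH i \in rowsH by rewrite mem_nth.
rewrite dual_codeP // of_wordK; first exact: (allP orth).
by apply/eqP; apply: (allP wfH).
Qed.

(** The list has 3^k entries and contains all 3^k codewords, so it has no repetition and counting in
    it counts codewords. *)
Lemma perm_spanw rows : wf_rows rows -> \dim (code rows) = size rows ->
  perm_eq (map to_word (enum (code rows))) (spanw n rows).
Proof.
move=> wf dimC; have szS : size (spanw n rows) = (3 ^ size rows)%N.
  by elim: (rows) => //= r rs IH; rewrite !size_cat !size_map IH expnS; lia.
have uE : uniq (map to_word (enum (code rows))).
  by rewrite map_inj_uniq ?enum_uniq //; exact: to_word_inj.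
have szE : size (map to_word (enum (code rows))) = (3 ^ size rows)%N.
  by rewrite size_map -cardE card_vspace dimC card_Fp.
have sub : {subset map to_word (enum (code rows)) <= spanw n rows}.
  by move=> _ /mapP [x xC ->]; rewrite -codeP //; rewrite mem_enum in xC.
have [_ eqi] := uniq_min_size uE sub ltac:(by rewrite szE szS).
by apply: uniq_perm => //; apply: (leq_size_uniq uE sub); rewrite szE szS.
Qed.

Lemma dist_countE rows v j : wf_rows rows -> \dim (code rows) = size rows ->
  dist_count j v (code rows) =
  count (fun s => distw (to_word v) s == j) (spanw n rows).
Proof.
move=> wf dimC; rewrite -(seq.permP (perm_spanw wf dimC)) count_map.
rewrite /dist_count -sum1_card -sum1_count [RHS]big_enum_cond /=.
by apply: eq_bigl => c; rewrite inE hdist_to_word.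
Qed.

End Words.

(** * Exhaustive searches over sets of positions *)

(** Tests whether every set of at most [w] among the first [k] positions is avoided by some word of
    [L]. Branching on the membership of the next position shares the filtering among all sets; once
    no position can be added, a nonempty list settles the branch. *)
Fixpoint nocov (k w : nat) (L : seq word) : bool :=
  if L is [::] then false else
  match k, w with
  | k'.+1, w'.+1 =>
      nocov k' w (map behead L) &&
      nocov k' w' (map behead (filter (fun s => ~~ isSome (head None s)) L))
  | _, _ => true
  end.

Lemma nocovP k w L (P : pred nat) : nocov k w L -> (count P (iota 0 k) <= w)%N ->
  exists2 s, s \in L & forall i, (i < k)%N -> P i -> nth None s i = None.
Proof.
elim: k w L P => [|k IHk] w L P; first by case: L => [|s L] //= _ _; exists s; rewrite ?mem_head.
case: L => [|s0 L0]; first by [].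
set L := s0 :: L0; case: w => [|w].
  move=> _; rewrite leqn0 => /eqP P0; exists s0; rewrite ?mem_head // => i ik Pi.
  have : has P (iota 0 k.+1) by apply/hasP; exists i; rewrite ?mem_iota.
  by rewrite has_count P0.
move=> /andP [H0 H1] /=; rewrite -[iota 1 k]/(iota (1 + 0) k) iotaDl count_map /= => Pw.
have nthB s i : nth None s i.+1 = nth None (behead s) i by case: s => //=; rewrite nth_nil.
case P0: (P 0%N) in Pw.
  have [_ /mapP [s + ->] Hs] := IHk _ _ (preim succn P) H1 ltac:(by rewrite add1n in Pw).
  rewrite mem_filter => /andP [s00 sL]; exists s => // -[|i] ik Pi; last by rewrite nthB Hs.
  by rewrite nth0; case: (head _ _) s00.
have [_ /mapP [s sL ->] Hs] := IHk _ _ (preim succn P) H0 ltac:(by []).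
by exists s => // -[|i] ik Pi; [rewrite P0 in Pi|rewrite nthB Hs].
Qed.


(* Lists, for every set [T] of exactly [w] positions, the second components of
   the pairs whose first component vanishes on [T]. *)
Fixpoint shortened (A : Type) (k w : nat) (L : seq (word * A)) : seq (seq A) :=
  match w, k with
  | 0, _ => [:: map snd L]
  | _.+1, 0 => [::]
  | w'.+1, k'.+1 =>
      let L' := map (fun p => (behead p.1, p.2)) in
      shortened k' w (L' L) ++
      shortened k' w' (L' (filter (fun p => ~~ isSome (head None p.1)) L))
  end.

Lemma shortenedP (A : eqType) k w (L : seq (word * A)) K : K \in shortened k w L ->
  exists2 P : pred nat, (count P (iota 0 k) <= w)%N &
  forall p, p \in L -> (forall i, (i < k)%N -> P i -> nth None p.1 i = None) -> p.2 \in K.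
Proof.
elim: k w L => [|k IHk] [|w] L //.
- rewrite inE => /eqP ->; exists pred0; rewrite ?count_pred0 // => p pL _.
  exact: (map_f snd).
- rewrite inE => /eqP ->; exists pred0; rewrite ?count_pred0 // => p pL _.
  exact: (map_f snd).
have nthB s i : nth None s i.+1 = nth None (behead s) i by case: s => //=; rewrite nth_nil.
have cntS (P : pred nat) : count P (iota 0 k.+1) = (P 0 + count (preim succn P) (iota 0 k))%N.
  by rewrite /= -[iota 1 k]/(iota (1 + 0) k) iotaDl count_map.
rewrite [shortened _ _ _]/= mem_cat => /orP [] /IHk [P Pw HP].
  exists (fun i => if i is i'.+1 then P i' else false); first by rewrite cntS.
  move=> p pL Hp; rewrite -[p.2]/(behead p.1, p.2).2; apply: HP.
    exact: (map_f (fun p => (behead p.1, p.2))).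
  by move=> i ik Pi; rewrite -nthB Hp.
exists (fun i => if i is i'.+1 then P i' else true); first by rewrite cntS.
move=> p pL Hp; rewrite -[p.2]/(behead p.1, p.2).2; apply: HP.
  apply: (map_f (fun p => (behead p.1, p.2))); rewrite mem_filter pL andbT.
  by rewrite -nth0 Hp.
by move=> i ik Pi; rewrite -nthB Hp.
Qed.

Lemma dotw_cat0 k s y : dotw s (nseq k None ++ y) = dotw (drop k s) y.
Proof.
elim: k s => [|k IHk] [|a s] //=.
by case: a => [a|]; rewrite IHk.
Qed.

(** The values of the functional [h] in the order of [allw], each tail table being computed once and
    reused for the three values of the new coordinate. *)
Fixpoint evalw (h : word) : seq trit :=
  if h is a :: h' then
    let E := evalw h' in E ++ map (tadd a) E ++ map (tadd (tneg a)) E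
  else [:: None].

Lemma evalwE h : evalw h = map (dotw h) (allw (size h)).
Proof.
elim: h => //= a h IHh; rewrite !map_cat -!map_comp IHh -!map_comp.
by congr (_ ++ (_ ++ _)); apply: eq_map => y /=; case: a => [[]|].
Qed.

(** Missing entries count as [false]: [zipand] cuts to the shorter list and [zipor] keeps the longer
    one, so both act pointwise under [nth false]. *)
Fixpoint zipand (s t : seq bool) : seq bool :=
  match s, t with a :: s', b :: t' => (if a then b else false) :: zipand s' t' | _, _ => [::] end.
Fixpoint zipor (s t : seq bool) : seq bool :=
  match s, t with
  | a :: s', b :: t' => (if a then true else b) :: zipor s' t'
  | [::], _ => t
  | _, [::] => s
  end.

Lemma nth_zipand s t i : nth false (zipand s t) i = nth false s i && nth false t i.
Proof.
by elim: s t i => [|a s IHs] [|b t] [|i] //=; rewrite ?nth_nil ?andbF //; case: a.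
Qed.

Lemma nth_zipor s t i : nth false (zipor s t) i = nth false s i || nth false t i.
Proof.
by elim: s t i => [|a s IHs] [|b t] [|i] //=; rewrite ?nth_nil ?orbF //; case: a.
Qed.

(* [all_pairs_met N [seq (m, m) | m <- masks]] decides whether any two positions
   below [N] are both marked in some mask. *)
Fixpoint all_pairs_met (N k : nat) (L : seq (seq bool * seq bool)) : bool :=
  if k is k'.+1 then
    let u := foldr (fun p acc => if head false p.2 then zipor p.1 acc else acc) [::] L in
    [&& size u == N, all id u & all_pairs_met N k' (map (fun p => (p.1, behead p.2)) L)]
  else true.

(** At each step [u] is the union of the masks that mark the current position; it has to fill all
    [N] places. *)
Lemma all_pairs_metP N k L i j : all_pairs_met N k L -> (i < k)%N -> (j < N)%N ->
  exists2 p, p \in L & nth false p.2 i && nth false p.1 j.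
Proof.
elim: k L i => [|k IHk] L i //=; set u := foldr _ _ _.
move=> /and3P [/eqP uN /allP uT H]; case: i => [_|i ik] jN; last first.
  have [_ /mapP [p pL ->] /=] := IHk _ _ H ik jN.
  by rewrite nth_behead => Hp; exists p.
have : nth false u j by apply: uT; rewrite mem_nth ?uN.
rewrite /u {u uN uT H}; elim: L => [|p L IHL] /=; first by rewrite nth_nil.
case: ifP => [p0|_ /IHL [p' p'L]]; last by exists p'; rewrite // inE p'L orbT.
rewrite nth_zipor => /orP [pj|/IHL [p' p'L]]; last by exists p'; rewrite // inE p'L orbT.
by exists p; rewrite ?mem_head // nth0 p0.
Qed.

Lemma count_positions n (T : {set 'I_n}) :
  count (fun i => [exists j : 'I_n, (j == i :> nat) && (j \in T)]) (iota 0 n) = #|T|.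
Proof.
rewrite -val_enum_ord count_map cardE -sum1_size big_enum /= -sum1_count big_enum_cond /=.
apply: eq_bigl => i; apply/existsP/idP => [[j /andP [/eqP /val_inj ->]]//|iT].
by exists i; rewrite eqxx.
Qed.

(** * Decision procedures for ternary codes *)

Definition word_of_seq (s : seq nat) : word :=
  map (fun d => match d with 0 => None | 1 => Some false | _ => Some true end) s.

Definition rows11 : seq word := map word_of_seq
  [:: [:: 1; 0; 0; 0; 0; 0; 2; 2; 2; 2; 2];
      [:: 0; 1; 0; 0; 0; 0; 2; 2; 1; 1; 0];
      [:: 0; 0; 1; 0; 0; 0; 2; 1; 2; 0; 1];
      [:: 0; 0; 0; 1; 0; 0; 1; 2; 0; 2; 1];
      [:: 0; 0; 0; 0; 1; 0; 1; 0; 2; 1; 2];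
      [:: 0; 0; 0; 0; 0; 1; 0; 1; 1; 2; 2]]%N.

(* A basis of the dual of [golay11], in systematic form. *)
Definition rows11d : seq word := map word_of_seq
  [:: [:: 1; 0; 0; 0; 0; 0; 2; 2; 2; 2; 2];
      [:: 0; 1; 0; 0; 0; 2; 2; 1; 0; 2; 1];
      [:: 0; 0; 1; 0; 0; 2; 2; 0; 1; 1; 2];
      [:: 0; 0; 0; 1; 0; 2; 1; 1; 2; 0; 2];
      [:: 0; 0; 0; 0; 1; 2; 1; 2; 1; 2; 0]]%N.

Definition rows10 : seq word := map (take 10) rows11d.

Definition rows12 : seq word := map word_of_seq
  [:: [:: 1; 0; 0; 0; 0; 0; 0; 1; 1; 1; 1; 1];
      [:: 0; 1; 0; 0; 0; 0; 1; 0; 1; 2; 2; 1];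
      [:: 0; 0; 1; 0; 0; 0; 1; 1; 0; 1; 2; 2];
      [:: 0; 0; 0; 1; 0; 0; 1; 2; 1; 0; 1; 2];
      [:: 0; 0; 0; 0; 1; 0; 1; 2; 2; 1; 0; 1];
      [:: 0; 0; 0; 0; 0; 1; 1; 1; 2; 2; 1; 0]]%N.

(* [rows] spans the dual code: for every set of [w] positions some dual word
   vanishes there without annihilating [X]. *)
Definition uncovered n rows (w : nat) (X : seq word) : bool :=
  nocov n w (filter (fun h => has (fun x => isSome (dotw x h)) X) (spanw n rows)).

Definition profile n rows y : seq nat :=
  foldr (fun s h => incr_nth h (distw y s)) (nseq n.+1 0%N) (spanw n rows).

(** The first nonzero index of a profile is the distance to the code, so this says that the profile
    depends on that distance alone. One representative per coset is enough, since translation by a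
    codeword preserves the profile. *)
Definition regular_table n rows (table : seq (seq nat)) : bool :=
  all (fun y => let p := profile n rows (nseq (size rows) None ++ y) in
                p == nth [::] table (find (fun b => b != 0%N) p))
      (allw (n - size rows)).

Definition weights_in n rows (W : seq nat) : bool :=
  all (fun s => wtw s \in 0%N :: W) (spanw n rows).

Definition union_weights n rows (W : seq nat) : bool :=
  let S := spanw n rows in
  all (fun w => has (fun s => has (fun t => unionw s t == w) S) S) W.

(* For a self-dual code, any two cosets of representatives [y], [y'] on the last
   coordinates are to be reached from a common set of [w] positions; mask [i] of
   such a set tells whether the i-th vector [y] is reached. *)
Definition pairs_covered n rows (w : nat) : bool :=
  let k := size rows in
  let N := (3 ^ (n - k))%N in
  let marked s := (s, map (fun a => ~~ isSome a) (evalw (drop k s))) in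
  let masks := map (foldr zipand (nseq N true)) (shortened n w (map marked (spanw n rows))) in
  all_pairs_met N N (map (fun u => (u, u)) masks).

Section Checks.
Variable n : nat.
Implicit Types (rows : seq word) (v : 'rV['F_3]_n) (C : {vspace 'rV['F_3]_n}).

Lemma weights_inP rows W : wf_rows n rows -> weights_in n rows W ->
  forall c, c \in code n rows -> c != 0 -> wt c \in W.
Proof.
move=> wf /allP H c cC c0; have := H (to_word c); rewrite -codeP // => /(_ cC).
by rewrite -wt_to_word inE wt_eq0 (negbTE c0).
Qed.

Lemma min_dist_code rows W r : wf_rows n rows -> weights_in n rows W ->
  r \in rows -> (0 < wtw r)%N -> all (leq (wtw r)) W ->
  min_dist (code n rows) = wtw r.
Proof.
move=> wf HW rr r0 /allP rW; have /eqP rn := allP wf _ rr.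
apply: min_distP => [|c cC c0]; last exact/rW/(weights_inP wf HW).
exists (of_word n r); rewrite mem_code_rows // of_word_wt //; split=> //.
by rewrite -wt_gt0 of_word_wt.
Qed.

Lemma uncoveredP (L : finFieldType) (iota : {rmorphism 'F_3 -> L}) m C rows w X :
  #|L| = (3 ^ m)%N -> dual C = code n rows -> wf_rows n rows -> wf_rows n X ->
  (size X <= m)%N -> uncovered n rows w X -> ~~ covers (lift_code iota C) w.
Proof.
move=> cardL dualC wf wfX Xm unc; apply/negP.
(* Rows beyond the end of [X] read as zero, so one list of witnesses serves every [m] that is at
   least its length. *)
move/(covers_liftP (isT : prime 3) iota cardL)/(_ (\matrix_(i < m) of_word n (nth [::] X i))).
move=> [T Tw HT]; have [] := nocovP unc (P := fun i => [exists j : 'I_n, (j == i :> nat) && (j \in T)]).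
  by rewrite count_positions.
move=> s; rewrite mem_filter => /andP [/hasP [x xX xs] sS] Hs.
have sn := size_spanw wf sS; have xn : size x = n by apply/eqP/(allP wfX).
have sC : of_word n s \in dual C by rewrite dualC codeP // of_wordK.
have sT : supp (of_word n s) \subset ~: T.
  apply/subsetP => j; rewrite !inE mxE t2F_eq0 negbK; apply: contraL => jT.
  by rewrite Hs //; apply/existsP; exists j; rewrite eqxx.
move: xX => /(nthP [::]) [i iX xi]; have /matrixP := HT _ sC sT.
move/(_ (Ordinal (leq_trans iX Xm)) 0); rewrite [RHS]mxE => dot0.
suff : dotp (of_word n x) (of_word n s) == 0 by rewrite of_word_dot // t2F_eq0 xs.
by rewrite -[X in _ == X]dot0 /dotp !mxE; apply/eqP/eq_bigr => k _; rewrite !mxE xi.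
Qed.

Lemma dist_count_translate C v c j : c \in C ->
  dist_count j (v - c) C = dist_count j v C.
Proof.
move=> cC; rewrite /dist_count -(card_imset _ (addrI c)); apply: eq_card => x.
rewrite inE; apply/imsetP/andP => [[y + ->]|[xC xj]].
  by rewrite inE => /andP [yC]; rewrite rpredD // !hdistE opprD addrA.
exists (x - c); rewrite ?subrKC // inE rpredB //.
by move: xj; rewrite !hdistE opprB addrA subrK.
Qed.

Lemma nth_profile rows y j :
  nth 0%N (profile n rows y) j = count (fun s => distw y s == j) (spanw n rows).
Proof.
rewrite /profile; elim: (spanw n rows) => [|s S IHS] /=.
  by apply: etrans (nth_nseq 0%N n.+1 0%N j) _; rewrite if_same.
by rewrite nth_incr_nth IHS.
Qed.

Lemma regular_tableP rows table : wf_rows n rows -> systematic n rows ->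
  regular_table n rows table -> completely_regular (code n rows).
Proof.
move=> wf sys /allP reg; set C : {vspace 'rV_n} := code n rows.
suff H v : exists2 p, (forall j, nth 0%N p j = dist_count j v C) &
    p = nth [::] table (dist_code v C).
  move=> v w vw j; have [p <- ->] := H v; have [p' <- ->] := H w.
  by rewrite vw.
have [c cC [y yA vy]] := systematic_coset v sys.
have /eqP := reg y yA; set p := profile _ _ _ => pE.
have nthp j : nth 0%N p j = dist_count j v C.
  by rewrite nth_profile -(dist_count_translate v j cC) dist_countE ?dim_code // vy.
exists p => //; rewrite pE; congr nth.
have dc0 : nth 0%N p (dist_code v C) != 0%N.
  rewrite nthp -lt0n; apply/card_gt0P; have [x xC xd] := dist_code_attained C v.
  by exists x; rewrite inE xC xd eqxx.
apply/eqP; rewrite eqn_leq; apply/andP; split.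
  by rewrite leqNgt; apply/negP => /(before_find 0%N); rewrite dc0.
rewrite leqNgt; apply/negP => lt_dc.
have /(nth_find 0%N) : has (fun b => b != 0%N) p.
  apply/hasP; exists (nth 0%N p (dist_code v C)) => //; apply: mem_nth.
  by rewrite ltnNge; apply: contra dc0 => ?; rewrite nth_default.
rewrite nthp -lt0n => /card_gt0P [x]; rewrite inE => /andP [xC /eqP xd].
by have := dist_code_le v xC; rewrite xd leqNgt lt_dc.
Qed.

Lemma union_weightsP (L : finFieldType) (iota : {rmorphism 'F_3 -> L}) m C rows W w :
  #|L| = (3 ^ m)%N -> (2 <= m)%N -> C = code n rows -> wf_rows n rows ->
  union_weights n rows W -> w \in W ->
  exists2 x, x \in lift_code iota C & wt x = w.
Proof.
move=> cardL m2 -> wf /allP H /H /hasP [s sS /hasP [t tS /eqP <-]].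
have memC r : r \in spanw n rows -> of_word n r \in code n rows.
  by move=> rS; rewrite codeP // of_wordK // (size_spanw wf).
have [x xC xw] := lift_union_weight (isT : prime 3) iota cardL m2 (memC s sS) (memC t tS).
by exists x; rewrite // xw card_supp_union !of_wordK // (size_spanw wf).
Qed.

(** A vector over the extension of degree 2 is a pair of ternary rows. Removing codewords changes no
    inner product with dual words, so each row is replaced by its systematic representative, whose
    index is looked up in the masks; both must be marked by the mask of one set [T]. *)
Lemma pairs_coveredP (L : finFieldType) (iota : {rmorphism 'F_3 -> L}) C rows w :
  #|L| = (3 ^ 2)%N -> C = code n rows -> dual C = C -> wf_rows n rows ->
  systematic n rows -> pairs_covered n rows w -> covers (lift_code iota C) w.
Proof.
move=> cardL CE dualC wf sys pairs; have /andP [kn _] := sys.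
apply/(covers_liftP (isT : prime 3) iota cardL) => X.
set r := (n - size rows)%N in pairs.
have sizeA k : size (allw k) = (3 ^ k)%N.
  by elim: k => //= k IH; rewrite !size_cat !size_map IH expnS; lia.
have [c0 c0C [y0 y0A x0]] := systematic_coset (row 0 X) sys.
have [c1 c1C [y1 y1A x1]] := systematic_coset (row 1 X) sys.
have [||p] := all_pairs_metP pairs (i := index y0 (allw r)) (j := index y1 (allw r)).
- by rewrite -sizeA index_mem.
- by rewrite -sizeA index_mem.
move=> /mapP [u /mapP [K KS uE] ->] /= /andP [u0 u1].
have [P Pw HP] := shortenedP KS.
exists [set j : 'I_n | P j].
  rewrite -count_positions; apply: leq_trans Pw; rewrite leq_eqVlt; apply/orP; left.
  apply/eqP/eq_in_count => i; rewrite mem_iota /= => ilt.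
  apply/existsP/idP => [[j /andP [/eqP <-]]|Pi]; first by rewrite inE.
  by exists (Ordinal ilt); rewrite /= eqxx inE.
move=> h hC hP; rewrite dualC in hC.
have hS : to_word h \in spanw n rows by rewrite -codeP // -CE.
have hK : map (fun a => ~~ isSome a) (evalw (drop (size rows) (to_word h))) \in K.
  have := HP _ (map_f (fun s => (s, map (fun a => ~~ isSome a) (evalw (drop (size rows) s)))) hS).
  apply=> i ilt Pi /=.
  rewrite (nth_to_word h (Ordinal ilt)); move/suppP: hP => -> //.
  by rewrite !inE negbK.
have foldand (K' : seq (seq bool)) i t : nth false (foldr zipand (nseq (3 ^ r) true) K') i ->
    t \in K' -> nth false t i.
  elim: K' => //= t' K' IHK; rewrite nth_zipand inE => /andP [t'i K'i].
  by case/predU1P => [->//|]; apply: IHK.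
have dot0 a c y : (row a X - c) = of_word n (nseq (size rows) None ++ y) -> c \in C -> size y = r ->
   y \in allw r -> nth false u (index y (allw r)) -> row a X *m h^T = 0.
  move=> xE cC ysz yA; rewrite uE => /foldand/(_ hK).
  rewrite evalwE size_drop size_to_word -/r (nth_map None) ?size_map ?index_mem //.
  rewrite (nth_map [::]) ?index_mem // nth_index // -dotw_cat0 => d0.
  apply/eqP; rewrite dotp_mx0 -(subrK c (row a X)) dotpDl.
  have -> : dotp c h = 0 by rewrite dotpC; move: hC; rewrite -{1}dualC => /dualP; apply.
  rewrite addr0 dotpC xE -{1}(to_wordK h) of_word_dot ?size_to_word //.
    by rewrite t2F_eq0.
  by rewrite size_cat size_nseq ysz /r subnKC.
have ysize y (x c : 'rV['F_3]_n) : to_word (x - c) = nseq (size rows) None ++ y -> size y = r.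
  move/(congr1 size); rewrite size_to_word size_cat size_nseq => nE.
  by apply/eqP; rewrite -(eqn_add2l (size rows)) -nE /r subnKC.
have toE y (x c : 'rV['F_3]_n) : to_word (x - c) = nseq (size rows) None ++ y ->
    x - c = of_word n (nseq (size rows) None ++ y).
  by move=> <-; rewrite to_wordK.
apply/row_matrixP => a; rewrite row_mul row0.
have [->|->] : a = 0 \/ a = 1.
  by case: a => [[|[|]]] // ?; [left|right]; apply: val_inj.
  by apply: (dot0 0 c0 y0); rewrite ?CE //; [exact: toE|exact: ysize x0].
by apply: (dot0 1 c1 y1); rewrite ?CE //; [exact: toE|exact: ysize x1].
Qed.

End Checks.

(** * Light words in subcodes *)

Section LightWords.
Variables (F : finFieldType) (n : nat).
Implicit Types (C D : {vspace 'rV[F]_n}) (T : {set 'I_n}).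
Local Notation q := #|F|.

Lemma plotkin_bound D T d : (D <= supp_space F T)%VS ->
  (forall h, h \in D -> h != 0 -> (d <= wt h)%N) ->
  (q * (d * (#|D| - 1)) <= #|T| * (q - 1) * #|D|)%N.
Proof.
move=> DT wtD; apply: leq_trans (plotkin_sum DT); rewrite leq_mul2l; apply/orP; right.
rewrite (bigD1 (0 : 'rV[F]_n)) ?mem0v //= wt0 add0n.
have -> : (#|D| - 1 = #|[pred h in D | h != 0%R]|)%N.
  by rewrite (cardD1 (0 : 'rV[F]_n)) mem0v add1n subn1; apply: eq_card => h; rewrite !inE andbC.
rewrite mulnC -sum_nat_const; apply: leq_sum => h.
by rewrite inE => /andP [hD h0]; apply: wtD.
Qed.

Lemma dim_check_code_ge m (X : 'M[F]_(m, n)) : (n - m <= \dim (check_code X))%N.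
Proof.
have := dim_dual (gen_code X); rewrite dual_gen_code => ->; apply: leq_sub2l.
have := limg_ker_dim (linfun (mulmxr X : 'rV[F]_m -> 'rV[F]_n)) fullv.
rewrite dimvf /dim /= mul1n => dimX.
by apply: leq_trans (leq_addl _ _) (eq_leq dimX).
Qed.

Lemma exists_subset_card (Z : {set 'I_n}) k : (k <= #|Z|)%N ->
  exists2 T : {set 'I_n}, T \subset Z & #|T| = k.
Proof.
rewrite -bin_gt0 -cards_draws => /card_gt0P [T]; rewrite inE => /andP [TZ /eqP Tk].
by exists T.
Qed.

(** No nonzero codeword fits into [T], so the positions of [T] are independent for the dual code and
    each zero imposed there costs one dimension. *)
Lemma subcode_vanishing_line C T : \dim (dual C) = #|T|.+1 -> (#|T| < min_dist C)%N ->
  \dim (dual C :&: supp_space F (~: T)) = 1%N.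
Proof.
move=> dimD Td; have := card_short C T.
have -> : #|(C :&: supp_space F T)%VS| = 1%N.
  rewrite (@eq_card _ _ (pred1 (0 : 'rV[F]_n))) ?card1 // => c.
  rewrite memv_cap mem_supp_space inE; apply/andP/eqP => [[cC cT]|->]; last first.
    by rewrite mem0v; split=> //; apply/suppP => i _; rewrite mxE.
  apply/eqP; apply: contraTT Td => c0; rewrite -leqNgt.
  by apply: leq_trans (min_dist_le cC c0) _; rewrite wtE subset_leq_card.
rewrite mul1n !card_vspace dimD expnSr => /eqP; rewrite eqn_pmul2l.
  by rewrite -{1}(expn1 q) eqn_exp2l ?card_field_gt1 // => /eqP.
by rewrite expn_gt0 (ltnW (card_field_gt1 F)).
Qed.

End LightWords.

(* The words of the dual that annihilate the [m] rows of [X] form a subcode of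
   positive dimension; by Plotkin averaging it has a light word [h], and for [R]
   zeros [T] of [h] the words of the dual vanishing on [T] are multiples of [h]. *)
Lemma lift_covers_light (p : nat) (p_pr : prime p) (L : finFieldType)
    (iota : {rmorphism 'F_p -> L}) m n (C : {vspace 'rV['F_p]_n}) R d :
  #|L| = (p ^ m)%N -> \dim (dual C) = R.+1 -> (R < min_dist C)%N -> (m <= R.+1)%N ->
  (forall h, h \in dual C -> h != 0 -> (wt h < d)%N -> (wt h + R <= n)%N) ->
  (n * (p - 1) * p ^ (R.+1 - m) < p * (d * (p ^ (R.+1 - m) - 1)))%N ->
  covers (lift_code iota C) R.
Proof.
move=> cardL dimD Rd mR light bound; apply/(covers_liftP p_pr iota cardL) => X.
pose D := (dual C :&: check_code X)%VS.
have dimDX : (R.+1 - m <= \dim D)%N.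
  have := dimv_sum_cap (dual C) (check_code X); rewrite -/D dimD => eqd.
  have := dim_le (dual C + check_code X); have := dim_check_code_ge X.
  have := dim_le (dual C); by rewrite dimD; lia.
have [h [hD h0 hd]] : exists h, [/\ h \in D, h != 0 & (wt h < d)%N].
  have [/existsP [h /and3P [hD h0 hd]]|] :=
    boolP [exists h, [&& h \in D, h != 0 & (wt h < d)%N]]; first by exists h.
  rewrite negb_exists => /forallP H.
  have DT : (D <= supp_space 'F_p setT)%VS.
    by apply/subvP => x _; rewrite mem_supp_space subsetT.
  have cardD : #|D| = (p ^ \dim D)%N by rewrite card_vspace card_Fp.
  have ND : (p ^ (R.+1 - m) <= #|D|)%N by rewrite cardD leq_exp2l ?prime_gt1.
  have N0 : (0 < p ^ (R.+1 - m))%N by rewrite expn_gt0 prime_gt0.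
  have : (p * (d * (#|D| - 1)) <= n * (p - 1) * #|D|)%N.
    have := plotkin_bound (d := d) DT.
    have -> : #|('F_p : finFieldType)| = p by exact: card_Fp.
    rewrite cardsT card_ord; apply.
    move=> x xD x0; by have := H x; rewrite xD x0 /= -leqNgt.
  (* [bound] contradicts Plotkin's inequality at the least possible size [N] of [D], and the
     contradiction persists for larger sizes. *)
  move: bound ND N0; set N := (p ^ _)%N; set A := (n * _)%N => bound ND N0.
  rewrite !mulnA in bound *; move: bound; set B := (p * d)%N => bound HH.
  have D0 : (0 < #|D|)%N by apply: leq_trans ND.
  have HN : (B * (#|D| - 1) * N <= A * #|D| * N)%N by rewrite leq_mul2r HH orbT.
  have HD : (A * N * #|D| < B * (N - 1) * #|D|)%N by rewrite ltn_mul2r D0.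
  have HB : (B * N <= B * #|D|)%N by rewrite leq_mul2l ND orbT.
  by move: HN HD HB; rewrite !mulnBr !muln1 !mulnBl; lia.
have [hC hX] : h \in dual C /\ X *m h^T = 0.
  by move: hD; rewrite memv_cap mem_check_code => /andP [? /eqP].
have [T TZ TR] : exists2 T : {set 'I_n}, T \subset ~: supp h & #|T| = R.
  by apply: exists_subset_card; rewrite card_setC_ord -wtE; have := light h hC h0 hd; lia.
exists T; first by rewrite TR.
move=> h' h'C h'T; have dimK := subcode_vanishing_line (C := C) (T := T).
rewrite TR in dimK; have {}dimK := dimK dimD Rd.
have hK : (<[h]> <= dual C :&: supp_space 'F_p (~: T))%VS.
  by rewrite -memvE memv_cap hC mem_supp_space -(setCK (supp h)) setCS.
have : h' \in <[h]>%VS.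
  have -> : <[h]>%VS = (dual C :&: supp_space 'F_p (~: T))%VS.
    by apply/eqP; rewrite eqEdim hK dimK dim_vline h0.
  by rewrite memv_cap h'C mem_supp_space.
by case/vlineP => a ->; rewrite linearZ /= -scalemxAr hX scaler0.
Qed.

Lemma lift_code_id n (C : {vspace 'rV['F_3]_n}) :
  lift_code (idfun : {rmorphism 'F_3 -> 'F_3}) C = C.
Proof.
rewrite -[RHS]check_code_parity_mx; congr check_code.
by apply/matrixP => i j; rewrite mxE.
Qed.

(** The moment with the common factor 3^t removed. The sum over the dual stops at [t], so few
    unknown dual counts enter the linear programs. *)
Lemma ternary_moment n (D : {vspace 'rV['F_3]_n}) k t : \dim D = k -> (t <= k)%N ->
  (3 ^ (k - t) * (\sum_(j < t.+1) weight_count j (dual D) * 'C(n - j, n - t)) =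
   \sum_(j < n.+1) weight_count j D * 'C(n - j, t))%N.
Proof.
move=> <- tk; have tn : (t <= n)%N := leq_trans tk (dim_le D).
have := weight_moment (dual D) tn; rewrite dualK card_vspace card_Fp //.
rewrite (bigID (fun j : 'I_n.+1 => j < t.+1)%N) /= [X in (_ + X)%N]big1 ?addn0; last first.
  move=> j; rewrite -leqNgt => tj; rewrite [X in (_ * X)%N]bin_small ?muln0 //.
  by have := ltn_ord j; lia.
rewrite -(big_ord_widen n.+1 (fun j => weight_count j (dual D) * 'C(n - j, n - t))%N) //.
rewrite -[in X in (_ * X)%N = _](subnK tk) expnD mulnC -mulnA mulnCA => /eqP.
by rewrite eqn_pmul2l ?expn_gt0 // => /eqP.
Qed.

(** * The Golay codes *)

Lemma golay12E : golay12 = code 12 rows12.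
Proof.
congr gen_code; apply/matrixP => i j; rewrite [RHS]mxE mxE.
case: (@split_ordP 6 6 j) => k ->; rewrite ?row_mxEl ?row_mxEr !mxE; apply/eqP;
  case: i k => [[|[|[|[|[|[|]]]]]] // ?] [[|[|[|[|[|[|]]]]]] // ?]; by vm_compute.
Qed.

Lemma golay11E : golay11 = code 11 rows11.
Proof.
congr gen_code; apply/matrixP => i j; rewrite [RHS]mxE mxE.
case: (@split_ordP 6 5 j) => k ->; rewrite ?row_mxEl ?row_mxEr !mxE; apply/eqP;
  [case: i k => [[|[|[|[|[|[|]]]]]] // ?] [[|[|[|[|[|[|]]]]]] // ?]
  |case: i k => [[|[|[|[|[|[|]]]]]] // ?] [[|[|[|[|[|]]]]] // ?]]; by vm_compute.
Qed.

(* A systematic basis of the dual of the punctured code. *)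
Definition rows10d : seq word := map word_of_seq
  [:: [:: 1; 0; 0; 0; 0; 2; 2; 1; 1; 0];
      [:: 0; 1; 0; 0; 0; 0; 2; 2; 1; 1];
      [:: 0; 0; 1; 0; 0; 1; 2; 2; 0; 2];
      [:: 0; 0; 0; 1; 0; 1; 1; 0; 1; 1];
      [:: 0; 0; 0; 0; 1; 2; 1; 2; 1; 2]]%N.

Lemma sys12 : systematic 12 rows12. Proof. by vm_compute. Qed.
Lemma sys11 : systematic 11 rows11. Proof. by vm_compute. Qed.
Lemma sys11d : systematic 11 rows11d. Proof. by vm_compute. Qed.
Lemma sys10 : systematic 10 rows10. Proof. by vm_compute. Qed.
Lemma sys10d : systematic 10 rows10d. Proof. by vm_compute. Qed.

Lemma weights12 : weights_in 12 rows12 [:: 6; 9; 12]%N.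
Proof. by vm_compute. Qed.
Lemma weights11 : weights_in 11 rows11 [:: 5; 6; 8; 9; 11]%N.
Proof. by vm_compute. Qed.
Lemma weights11d : weights_in 11 rows11d [:: 6; 9]%N.
Proof. by vm_compute. Qed.
Lemma weights10 : weights_in 10 rows10 [:: 5; 6; 8; 9]%N.
Proof. by vm_compute. Qed.
Lemma weights10d : weights_in 10 rows10d [:: 5; 6; 8; 9]%N.
Proof. by vm_compute. Qed.

Lemma dual_golay12 : dual golay12 = golay12.
Proof.
by rewrite golay12E; apply: dual_code; rewrite ?(dim_code sys12) //; vm_compute.
Qed.

Lemma golay11_dualE : golay11_dual = code 11 rows11d.
Proof.
by rewrite /golay11_dual golay11E; apply: dual_code; rewrite ?(dim_code sys11d) //; vm_compute.
Qed.

Lemma dual_golay11_dual : dual golay11_dual = golay11.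
Proof. exact: dualK. Qed.

Lemma dual_code10 : dual (code 10 rows10) = code 10 rows10d.
Proof. by apply: dual_code; rewrite ?(dim_code sys10d) //; vm_compute. Qed.

Lemma golay12_params : code_params golay12 6 6.
Proof.
rewrite golay12E; split; first by rewrite (dim_code sys12).
by rewrite (min_dist_code (r := nth [::] rows12 0) _ weights12) //; vm_compute.
Qed.

Lemma golay11_params : code_params golay11 6 5.
Proof.
rewrite golay11E; split; first by rewrite (dim_code sys11).
by rewrite (min_dist_code (r := nth [::] rows11 1) _ weights11) //; vm_compute.
Qed.

Lemma golay11_dual_params : code_params golay11_dual 5 6.
Proof.
rewrite golay11_dualE; split; first by rewrite (dim_code sys11d).
by rewrite (min_dist_code (r := nth [::] rows11d 0) _ weights11d) //; vm_compute.
Qed.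

Lemma golay12_near_MDS : near_MDS golay12.
Proof. by case: golay12_params => d6 m6; rewrite /near_MDS dual_golay12 d6 m6. Qed.

Lemma golay11_near_MDS : near_MDS golay11.
Proof.
case: golay11_params => d6 m5; case: golay11_dual_params => _.
by rewrite /golay11_dual => m6; rewrite /near_MDS d6 m5 m6.
Qed.

Lemma golay11_dual_near_MDS : near_MDS golay11_dual.
Proof.
case: golay11_params => _ m5; case: golay11_dual_params => d5 m6.
by rewrite /near_MDS dual_golay11_dual d5 m5 m6.
Qed.

Lemma golay12_weights c : c \in golay12 -> c != 0 -> wt c \in [:: 6; 9; 12]%N.
Proof. by rewrite golay12E; apply: (weights_inP _ weights12). Qed.

Lemma golay11_weights c : c \in golay11 -> c != 0 -> wt c \in [:: 5; 6; 8; 9; 11]%N.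
Proof. by rewrite golay11E; apply: (weights_inP _ weights11). Qed.

Lemma golay11_dual_weights c : c \in golay11_dual -> c != 0 -> wt c \in [:: 6; 9]%N.
Proof. by rewrite golay11_dualE; apply: (weights_inP _ weights11d). Qed.

(** The ternary code is its own lift along the identity, so the test for lifts applies with
    [m := 1]. *)
Lemma not_covers_code n (C : {vspace 'rV['F_3]_n}) rows w x :
  dual C = code n rows -> wf_rows n rows -> wf_rows n [:: x] ->
  uncovered n rows w [:: x] -> ~~ covers C w.
Proof.
move=> dualC wf wfx unc; rewrite -(lift_code_id C).
by apply: (uncoveredP _ (m := 1) _ dualC wf wfx _ unc) => //; exact: card_Fp.
Qed.

Lemma covering_radius_golay12 : covering_radius golay12 = 3%N.
Proof.
apply: covering_radiusP.
  apply: (delsarte_covers (W := [:: 6; 9; 12]%N)) => // h.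
  by rewrite dual_golay12; apply: golay12_weights.
(* The vector has weight 3, half the minimum distance, hence distance 3 from the code. *)
apply: (not_covers_code (rows := rows12)
  (x := word_of_seq [:: 0; 0; 0; 0; 0; 0; 0; 2; 0; 1; 0; 1]%N)) => //.
by rewrite dual_golay12 golay12E.
Qed.

Lemma covering_radius_golay11 : covering_radius golay11 = 2%N.
Proof.
apply: covering_radiusP.
  by apply: (delsarte_covers (W := [:: 6; 9]%N)) => // h; apply: golay11_dual_weights.
apply: (not_covers_code (rows := rows11d)
  (x := word_of_seq [:: 0; 0; 0; 0; 0; 0; 0; 2; 0; 1; 0]%N)) => //.
exact: golay11_dualE.
Qed.

Lemma covering_radius_golay11_dual : covering_radius golay11_dual = 5%N.
Proof.
apply: covering_radiusP.
  apply: (delsarte_covers (W := [:: 5; 6; 8; 9; 11]%N)) => // h.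
  by rewrite dual_golay11_dual; apply: golay11_weights.
apply: (not_covers_code (rows := rows11)
  (x := word_of_seq [:: 0; 1; 1; 1; 1; 1; 0; 0; 0; 0; 0]%N)) => //.
by rewrite dual_golay11_dual golay11E.
Qed.

Lemma covering_radius_code10 : covering_radius (code 10 rows10) = 4%N.
Proof.
apply: covering_radiusP.
  apply: (delsarte_covers (W := [:: 5; 6; 8; 9]%N)) => // h.
  by rewrite dual_code10; apply: (weights_inP _ weights10d).
apply: (not_covers_code (rows := rows10d)
  (x := word_of_seq [:: 0; 2; 0; 1; 1; 0; 0; 0; 1; 2]%N)) => //.
exact: dual_code10.
Qed.

(** * Complete regularity, the dual inside the Golay code, and puncturing *)

(* Row [d] lists the numbers of codewords at distance 0, 1, 2, ... from a vector
   at distance [d] from the code. *)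
Definition table11d : seq (seq nat) :=
  [:: [:: 1; 0; 0; 0; 0; 0; 132; 0; 0; 110; 0; 0];
      [:: 0; 1; 0; 0; 0; 36; 36; 60; 45; 45; 20; 0];
      [:: 0; 0; 1; 0; 9; 18; 45; 54; 60; 36; 18; 2];
      [:: 0; 0; 0; 3; 6; 21; 39; 60; 57; 39; 15; 3];
      [:: 0; 0; 0; 0; 15; 15; 36; 60; 60; 45; 6; 6];
      [:: 0; 0; 0; 0; 0; 66; 0; 0; 165; 0; 0; 12]]%N.

Definition table10 : seq (seq nat) :=
  [:: [:: 1; 0; 0; 0; 0; 72; 60; 0; 90; 20; 0];
      [:: 0; 1; 0; 0; 18; 36; 54; 60; 45; 27; 2];
      [:: 0; 0; 1; 4; 13; 34; 55; 64; 46; 22; 4];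
      [:: 0; 0; 0; 6; 15; 27; 60; 60; 54; 15; 6];
      [:: 0; 0; 0; 0; 30; 36; 0; 120; 45; 0; 12]]%N.

Lemma regular11d : regular_table 11 rows11d table11d. Proof. by vm_compute. Qed.
Lemma regular10 : regular_table 10 rows10 table10. Proof. by vm_compute. Qed.

Lemma golay11_dual_regular : completely_regular golay11_dual.
Proof. by rewrite golay11_dualE; apply: regular_tableP sys11d regular11d. Qed.

Lemma code10_regular : completely_regular (code 10 rows10).
Proof. exact: regular_tableP sys10 regular10. Qed.

(** Over F_3 a word has inner product [wt] mod 3 with itself. The Golay code exceeds its dual by one
    dimension, so its self-orthogonal words are exactly the dual words, and its weights divisible by
    3 are 0, 6 and 9. The evaluation confirms this word by word. *)
Lemma rows11_weights_0_6_9 :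
  all (fun s => (wtw s \in [:: 0; 6; 9]%N) == all (fun r => dotw r s == None) rows11)
      (spanw 11 rows11).
Proof. by vm_compute. Qed.

Lemma golay11_dual_memE x :
  (x \in golay11_dual) = (x \in golay11) && (wt x \in [:: 0; 6; 9]%N).
Proof.
have sub : (golay11_dual <= golay11)%VS.
  rewrite -dual_golay11_dual golay11_dualE; apply/subvP => c.
  rewrite mem_gen_code => /submxP [u ->]; rewrite mulmx_sum_row memv_suml // => i _.
  apply: memvZ; rewrite rowK dual_codeP // of_wordK.
    by case: i => [[|[|[|[|[|]]]]] // ?]; vm_compute.
  by case: i => [[|[|[|[|[|]]]]] // ?]; vm_compute.
apply/idP/andP => [xC|[]].
  split; first exact: (subvP sub).
  rewrite inE wt_eq0; have [//|x0] := eqVneq x 0.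
  exact: golay11_dual_weights.
rewrite golay11E codeP // => /(allP rows11_weights_0_6_9) /eqP H; rewrite wt_to_word H => orth.
by rewrite /golay11_dual golay11E dual_codeP.
Qed.

Lemma puncture_golay11_dual :
  puncture (ord_max : 'I_11) golay11_dual = code 10 rows10.
Proof.
rewrite golay11_dualE; apply/vspaceP => x; rewrite mem_gen_code.
have genE : gen_mx 10 rows10 = col' ord_max (gen_mx 11 rows11d).
  apply/matrixP => i j; rewrite !mxE lift_max.
  by rewrite (nth_map [::]) ?ltn_ord // nth_take.
apply/memv_imgP/submxP => [[c + ->]|[u ->]].
  rewrite mem_gen_code => /submxP [u ->]; exists u.
  by rewrite lfunE /= genE; apply/rowP => j; rewrite !mxE; apply: eq_bigr => k _; rewrite !mxE.
exists (u *m gen_mx 11 rows11d); first by rewrite mem_gen_code submxMl.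
by rewrite lfunE /= genE; apply/rowP => j; rewrite !mxE; apply: eq_bigr => k _; rewrite !mxE.
Qed.

Lemma code10_params : code_params (code 10 rows10) 5 5.
Proof.
split; first by rewrite (dim_code sys10).
by rewrite (min_dist_code (r := nth [::] rows10 0) _ weights10) //; vm_compute.
Qed.

(* A monomial map, found by search, from the punctured code onto its dual. *)
Definition swap_index : seq nat := [:: 0; 1; 2; 3; 6; 7; 4; 5; 9; 8]%N.
Definition swap_sign : word := word_of_seq [:: 1; 1; 1; 1; 2; 2; 2; 2; 1; 1]%N.

Definition swap (s : word) : word :=
  [seq tmul (nth None swap_sign i) (nth None s (nth 0%N swap_index i)) | i <- iota 0 10].

Lemma swap_orthogonal :
  all (fun s => all (fun r => dotw r (swap s) == None) rows10) (spanw 10 rows10).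
Proof. by vm_compute. Qed.

(** The evaluation gives only that [phi] maps the code into its dual; injectivity and the common
    dimension 5 make this map onto, which yields the converse. *)
Lemma code10_self_dual : self_dual_equiv (code 10 rows10).
Proof.
pose f (i : 'I_10) : 'I_10 := inord (nth 0%N swap_index i).
have fE i : f i = nth 0%N swap_index i :> nat.
  by rewrite inordK //; case: i => [[|[|[|[|[|[|[|[|[|[|]]]]]]]]]] // ?].
have fK : involutive f.
  move=> i; apply: val_inj; rewrite /= fE fE.
  by case: i => [[|[|[|[|[|[|[|[|[|[|]]]]]]]]]] // ?].
pose a (i : 'I_10) := t2F (nth None swap_sign i).
have a0 i : a i != 0 by rewrite t2F_eq0; case: i => [[|[|[|[|[|[|[|[|[|[|]]]]]]]]]] // ?].
exists (perm (inv_inj fK)), a; split=> // x.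
pose phi (y : 'rV['F_3]_10) : 'rV['F_3]_10 := \row_i (a i * y 0 (f i)).
have -> : \row_i (a i * x 0 (perm (inv_inj fK) i)) = phi x.
  by apply/rowP => i; rewrite !mxE permE.
have phi_inj : injective phi.
  move=> y z /rowP yz; apply/rowP => i; have := yz (f i); rewrite !mxE fK.
  by apply: mulfI.
have phiE y : to_word (phi y) = swap (to_word y).
  apply: (@eq_from_nth _ None); first by rewrite size_to_word.
  rewrite size_to_word => i ilt; rewrite (nth_to_word _ (Ordinal ilt)).
  rewrite (nth_map 0%N) ?size_iota // nth_iota // add0n -(fE (Ordinal ilt)) nth_to_word.
  by apply: (can_inj t2FK); rewrite t2F_mul !F2tK mxE.
have phiP y : y \in code 10 rows10 -> phi y \in dual (code 10 rows10).
  by rewrite codeP // dual_codeP // phiE => /(allP swap_orthogonal).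
apply/idP/idP => [/phiP //|].
have imE : [set phi y | y in code 10 rows10] = [set y in dual (code 10 rows10)].
  apply/eqP; rewrite eqEcard card_imset // cardsE !card_vspace dim_dual (dim_code sys10).
  by rewrite leqnn andbT; apply/subsetP => _ /imsetP [y yC ->]; rewrite inE phiP.
move=> xD; have : phi x \in [set y in dual (code 10 rows10)] by rewrite inE.
by rewrite -imE => /imsetP [y yC /phi_inj ->].
Qed.

(** * Linear programming bounds for minimum weight words *)

(* The minimal weight counts come from linear programming: [lia] combines the
   first binomial moments with the nonnegativity of all weight counts. *)
Ltac compute_numerals :=
  repeat match goal with
  | |- context [binomial ?a ?b] =>
      let v := eval vm_compute in (binomial a b) in change (binomial a b) with v
  | |- context [expn ?a ?b] =>
      let v := eval vm_compute in (expn a b) in change (expn a b) with v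
  end.

(** A certificate is f(z) = z (z-3)^2 (z-5), where z is the number of zeros of a word: f is
    nonpositive at 0, ..., 5, and its binomial coefficients -16, 26, -30, 24 give every dual count a
    positive coefficient. As f(6) = 54, this yields 54 A_6 >= 14256. The factor z is why the moment
    of order 0 is absent. *)
Lemma weight_count6_ge_12 (D : {vspace 'rV['F_3]_12}) :
  code_params D 6 6 -> (264 <= weight_count 6 D)%N.
Proof.
move=> [dimD dD].
have small j : (0 < j < 6)%N -> weight_count j D = 0%N.
  by move=> j6; rewrite weight_count_small // dD.
have M t := @ternary_moment _ D _ t dimD.
move: (M 4 isT) (M 3 isT) (M 2 isT) (M 1 isT).
rewrite !(big_ord_recl, big_ord0) /= /bump /= ?add1n ?add0n !weight_count0.
rewrite (small 1) // (small 2) // (small 3) // (small 4) // (small 5) //.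
compute_numerals.
by lia.
Qed.

(** Here (z-2)^2 (z-4) is a certificate, nonpositive at z = 0, ..., 4 and equal to 9 at z = 5; it
    gives 9 A_6 >= 1188. *)
Lemma weight_count6_ge_11 (D : {vspace 'rV['F_3]_11}) :
  code_params D 5 6 -> (132 <= weight_count 6 D)%N.
Proof.
move=> [dimD dD].
have small j : (0 < j < 6)%N -> weight_count j D = 0%N.
  by move=> j6; rewrite weight_count_small // dD.
have M t := @ternary_moment _ D _ t dimD.
move: (M 3 isT) (M 2 isT) (M 1 isT) (M 0%N isT).
rewrite !(big_ord_recl, big_ord0) /= /bump /= ?add1n ?add0n !weight_count0.
rewrite (small 1) // (small 2) // (small 3) // (small 4) // (small 5) //.
compute_numerals.
by lia.
Qed.

(** Here z (z-2) (z-3) (z-5) is a certificate, negative only at z = 1 and z = 4 among 0, ..., 5 and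
    equal to 72 at z = 6; it gives 72 A_5 >= 9504. *)
Lemma weight_count5_ge (D : {vspace 'rV['F_3]_11}) :
  code_params D 6 5 -> (132 <= weight_count 5 D)%N.
Proof.
move=> [dimD dD].
have small j : (0 < j < 5)%N -> weight_count j D = 0%N.
  by move=> j5; rewrite weight_count_small // dD.
have M t := @ternary_moment _ D _ t dimD.
move: (M 4 isT) (M 3 isT) (M 2 isT) (M 1 isT).
rewrite !(big_ord_recl, big_ord0) /= /bump /= ?add1n ?add0n !weight_count0.
rewrite (small 1) // (small 2) // (small 3) // (small 4) //.
compute_numerals.
by lia.
Qed.

(** The certificate for the lower bound is tight: the weights 10 and 7, where it is negative, do not
    occur, and neither do the dual weights 1 to 4. *)
Lemma weight_count5_golay11 : weight_count 5 golay11 = 132%N.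
Proof.
have [dimD dD] := golay11_params; have [_ dD'] := golay11_dual_params.
have small j : (0 < j < 5)%N -> weight_count j golay11 = 0%N.
  by move=> j5; rewrite weight_count_small // dD.
have smalld j : (0 < j < 6)%N -> weight_count j (dual golay11) = 0%N.
  by move=> j6; rewrite weight_count_small // dD'.
have absent j : (0 < j)%N -> j \notin [:: 5; 6; 8; 9; 11]%N -> weight_count j golay11 = 0%N.
  move=> j0 jW; apply: weight_count_eq0 => // c cC c0.
  by apply: contraNneq jW => <-; apply: golay11_weights.
have M t := @ternary_moment _ golay11 _ t dimD.
move: (M 4 isT) (M 3 isT) (M 2 isT) (M 1 isT).
rewrite !(big_ord_recl, big_ord0) /= /bump /= ?add1n ?add0n !weight_count0.
rewrite (small 1) // (small 2) // (small 3) // (small 4) // (absent 7) // (absent 10) //.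
rewrite (smalld 1) // (smalld 2) // (smalld 3) // (smalld 4) //.
compute_numerals.
by lia.
Qed.

(** The weight identity divided by [k] shows that the gap between the bound and A_d is exactly
    A_{d+1} / k. *)
Lemma Amax_of_near_MDS (F : finFieldType) n (D : {vspace 'rV[F]_n}) k d :
  (0 < k)%N -> code_params D k d -> near_MDS D ->
  (weight_count d D)%:R <= Amax n k #|F| ?= iff (weight_count d.+1 D == 0%N).
Proof.
move=> k0 [dimD dD] nmds; have [_] := nmds; rewrite dD dimD => dE.
have := near_MDS_weights dimD k0 nmds; rewrite -dE => E.
have k0' : (0 : rat) < k%:R by rewrite ltr0n.
have Er : 'C(n, k.-1)%:R * (#|F|%:R - 1) =
    k%:R * (weight_count d D)%:R + (weight_count d.+1 D)%:R :> rat.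
  by rewrite -natrM -natrD E natrM natrB ?(ltnW (card_field_gt1 F)).
have -> : Amax n k #|F| = (weight_count d D)%:R + (weight_count d.+1 D)%:R / k%:R.
  by rewrite /Amax mulrA Er; field; rewrite lt0r_neq0.
split.
  by rewrite lerDl divr_ge0 // ?ler0n // ltW.
rewrite addrC -subr_eq subrr eq_sym mulf_eq0 invr_eq0 (negbTE (lt0r_neq0 k0')) orbF.
by rewrite pnatr_eq0.
Qed.

(** * Lifted Golay codes *)

Lemma union_weights12 : union_weights 12 rows12 [:: 6; 8; 9; 10; 11; 12]%N.
Proof. by lazy. Qed.
Lemma union_weights11 : union_weights 11 rows11 [:: 5; 6; 7; 8; 9; 10; 11]%N.
Proof. by lazy. Qed.
Lemma union_weights11d : union_weights 11 rows11d [:: 6; 8; 9; 10; 11]%N.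
Proof. by lazy. Qed.
Lemma pairs_covered12 : pairs_covered 12 rows12 4. Proof. by vm_compute. Qed.

(** A plane inside seven coordinates with nonzero weights at least 6 would violate Plotkin's
    inequality: 3·6·8 = 144 exceeds 7·2·9 = 126. *)
Lemma dim_short_subcode n (C : {vspace 'rV['F_3]_n}) (T : {set 'I_n}) :
  (forall c, c \in C -> c != 0 -> (6 <= wt c)%N) -> #|T| = 7%N ->
  (\dim (C :&: supp_space 'F_3 T) <= 1)%N.
Proof.
move=> wtC T7; set D := (C :&: _)%VS.
have cardD : #|D| = (3 ^ \dim D)%N by rewrite card_vspace card_Fp.
have /(_ 6%N) := @plotkin_bound _ _ D T _ (capvSr C _).
have -> : #|('F_3 : finFieldType)| = 3%N by exact: card_Fp.
have wtD h : h \in D -> h != 0 -> (6 <= wt h)%N.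
  by rewrite memv_cap => /andP [hC _]; apply: wtC.
move=> /(_ wtD); rewrite T7 cardD => bound; rewrite leqNgt; apply/negP => dim2.
have : (3 ^ 2 <= 3 ^ \dim D)%N by rewrite leq_exp2l.
by move: bound; set N := (3 ^ \dim D)%N; lia.
Qed.

Section LiftedGolay.
Variables (m : nat) (L : finFieldType) (iota : {rmorphism 'F_3 -> L}).
Hypothesis cardL : #|L| = (3 ^ m)%N.
Let pr3 : prime 3 := isT.

Lemma lift_no_weight7 n (C : {vspace 'rV['F_3]_n}) W x :
  (forall c, c \in C -> c != 0 -> wt c \in W) -> all (leq 6) W -> 7%N \notin W ->
  x \in lift_code iota C -> wt x <> 7%N.
Proof.
move=> wtC W6 W7 xC x7; have x0 : x != 0 by rewrite -wt_gt0 x7.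
have [|c cC] := lift_weight_line pr3 cardL _ xC x0; rewrite x7.
  by move=> T T7; apply: dim_short_subcode => // c cC c0; apply: (allP W6); apply: wtC.
move=> c7; case/negP: W7; rewrite -c7; apply: wtC => //.
by rewrite -wt_gt0 c7.
Qed.

Lemma lift_golay12_no_weight7 x : x \in lift_code iota golay12 -> wt x <> 7%N.
Proof. exact: (lift_no_weight7 golay12_weights). Qed.

Lemma lift_golay11_dual_no_weight7 x : x \in lift_code iota golay11_dual -> wt x <> 7%N.
Proof. exact: (lift_no_weight7 golay11_dual_weights). Qed.

Lemma lift_golay12_params : code_params (lift_code iota golay12) 6 6.
Proof. exact: (code_params_lift pr3 iota cardL _ golay12_params). Qed.

Lemma lift_golay11_params : code_params (lift_code iota golay11) 6 5.
Proof. exact: (code_params_lift pr3 iota cardL _ golay11_params). Qed.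

Lemma lift_golay11_dual_params : code_params (lift_code iota golay11_dual) 5 6.
Proof. exact: (code_params_lift pr3 iota cardL _ golay11_dual_params). Qed.

Lemma lift_golay12_near_MDS : near_MDS (lift_code iota golay12).
Proof. exact: (near_MDS_lift pr3 iota cardL golay12_near_MDS). Qed.

Lemma lift_golay11_near_MDS : near_MDS (lift_code iota golay11).
Proof. exact: (near_MDS_lift pr3 iota cardL golay11_near_MDS). Qed.

Lemma lift_golay11_dual_near_MDS : near_MDS (lift_code iota golay11_dual).
Proof. exact: (near_MDS_lift pr3 iota cardL golay11_dual_near_MDS). Qed.

Lemma dual_lift_golay12 : dual (lift_code iota golay12) = lift_code iota golay12.
Proof. by rewrite (dual_lift pr3 iota cardL) dual_golay12. Qed.

Lemma dual_lift_golay11 : dual (lift_code iota golay11) = lift_code iota golay11_dual.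
Proof. exact: (dual_lift pr3 iota cardL). Qed.

Lemma dual_lift_golay11_dual : dual (lift_code iota golay11_dual) = lift_code iota golay11.
Proof. by rewrite (dual_lift pr3 iota cardL) dual_golay11_dual. Qed.

Lemma weight_in_range n (C : {vspace 'rV[L]_n}) (W : seq nat) x :
  (forall x, x \in C -> wt x <> 7%N) ->
  (forall w, (min_dist C <= w <= n)%N -> w != 7%N -> w \in W) ->
  x \in C -> x != 0 -> wt x \in W.
Proof.
move=> no7 HW xC x0; apply: HW; last by apply/eqP/no7.
by rewrite min_dist_le // wt_le.
Qed.

Lemma dual_lift_golay12_weights h :
  h \in dual (lift_code iota golay12) -> h != 0 -> wt h \in [:: 6; 8; 9; 10; 11; 12]%N.
Proof.
rewrite dual_lift_golay12; apply: weight_in_range; first exact: lift_golay12_no_weight7.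
have [_ ->] := lift_golay12_params.
by do 13!case=> //.
Qed.

Lemma dual_lift_golay11_weights h :
  h \in dual (lift_code iota golay11) -> h != 0 -> wt h \in [:: 6; 8; 9; 10; 11]%N.
Proof.
rewrite dual_lift_golay11; apply: weight_in_range; first exact: lift_golay11_dual_no_weight7.
have [_ ->] := lift_golay11_dual_params.
by do 12!case=> //.
Qed.

Lemma covering_radius_lift_golay12_ge6 :
  (6 <= m)%N -> covering_radius (lift_code iota golay12) = 6%N.
Proof.
move=> m6; apply: covering_radiusP.
  exact: (delsarte_covers (W := [:: 6; 8; 9; 10; 11; 12]%N) _ _ dual_lift_golay12_weights).
(* The first six unit vectors are annihilated by no nonzero dual word, as these six positions are an
   information set; and five zeros never exhaust a code of dimension 6. *)
apply: (uncoveredP iota cardL (rows := rows12) _ _ _ m6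
  (X := map word_of_seq
   [:: [:: 1; 0; 0; 0; 0; 0; 0; 0; 0; 0; 0; 0];
       [:: 0; 1; 0; 0; 0; 0; 0; 0; 0; 0; 0; 0];
       [:: 0; 0; 1; 0; 0; 0; 0; 0; 0; 0; 0; 0];
       [:: 0; 0; 0; 1; 0; 0; 0; 0; 0; 0; 0; 0];
       [:: 0; 0; 0; 0; 1; 0; 0; 0; 0; 0; 0; 0];
       [:: 0; 0; 0; 0; 0; 1; 0; 0; 0; 0; 0; 0]]%N)) => //.
by rewrite dual_golay12 golay12E.
Qed.

Lemma covering_radius_lift_golay11_ge4 :
  (4 <= m)%N -> covering_radius (lift_code iota golay11) = 5%N.
Proof.
move=> m4; apply: covering_radiusP.
  exact: (delsarte_covers (W := [:: 6; 8; 9; 10; 11]%N) _ _ dual_lift_golay11_weights).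
(* The dual words that annihilate these four vectors form a line spanned by a word of weight 9,
   which has only two zeros. *)
apply: (uncoveredP iota cardL (rows := rows11d) golay11_dualE _ _ m4
  (X := map word_of_seq
   [:: [:: 0; 0; 0; 0; 0; 0; 0; 2; 0; 1; 0];
       [:: 0; 0; 0; 0; 0; 0; 1; 1; 1; 2; 1];
       [:: 0; 0; 0; 0; 0; 0; 0; 0; 1; 0; 1];
       [:: 0; 0; 0; 0; 0; 0; 1; 2; 0; 2; 1]]%N)) => //.
Qed.

Lemma covering_radius_lift_golay11_23 :
  m = 2%N \/ m = 3%N -> covering_radius (lift_code iota golay11) = 4%N.
Proof.
move=> m23; have m2 : (2 <= m)%N by lia.
apply: covering_radiusP.
  apply: (lift_covers_light pr3 (d := 9) iota cardL).
  - by have [] := golay11_dual_params.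
  - by have [_ ->] := golay11_params.
  - by lia.
  - by move=> h hC h0; have := golay11_dual_weights hC h0; rewrite !inE => /orP [] /eqP ->.
  (* Plotkin against minimum weight 9: 11·2·27 = 594 < 702 = 3·9·26 for m = 2, and 11·2·9 = 198 <
     216 = 3·9·8 for m = 3. *)
  - by case: m23 => ->.
apply: (uncoveredP iota cardL (rows := rows11d) golay11_dualE _ _ m2
  (X := map word_of_seq
   [:: [:: 0; 0; 0; 0; 0; 0; 1; 1; 2; 0; 1];
       [:: 0; 0; 0; 0; 0; 0; 2; 2; 2; 2; 1]]%N)) => //.
Qed.

Lemma covering_radius_lift_golay12_3 :
  m = 3%N -> covering_radius (lift_code iota golay12) = 5%N.
Proof.
move=> m3; apply: covering_radiusP.
  apply: (lift_covers_light pr3 (d := 9) iota cardL).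
  - by rewrite dual_golay12; have [] := golay12_params.
  - by have [_ ->] := golay12_params.
  - by rewrite m3.
  - move=> h; rewrite dual_golay12 => hC h0; have := golay12_weights hC h0.
    by rewrite !inE => /or3P [] /eqP ->.
  (* Plotkin against minimum weight 9: 12·2·27 = 648 < 702 = 3·9·26. *)
  - by rewrite m3.
have m3' : (3 <= m)%N by rewrite m3.
apply: (uncoveredP iota cardL (rows := rows12) _ _ _ m3'
  (X := map word_of_seq
   [:: [:: 0; 0; 0; 0; 0; 0; 0; 2; 0; 1; 0; 1];
       [:: 0; 0; 0; 0; 0; 0; 1; 1; 2; 1; 0; 0];
       [:: 0; 0; 0; 0; 0; 0; 1; 0; 1; 1; 2; 0]]%N)) => //.
by rewrite dual_golay12 golay12E.
Qed.

(** The first six positions are an information set of the dual, so no nonzero dual word vanishes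
    there. This crude bound suffices, since the lifted dual has seven nonzero weights, 5 to 11, once
    m >= 2. *)
Lemma lift_golay11_dual_covers : covers (lift_code iota golay11_dual) 6.
Proof.
apply/(covers_liftP pr3 iota cardL) => X; exists [set i : 'I_11 | (i < 6)%N].
  rewrite -sum1_card (eq_bigl (fun i : 'I_11 => i < 6)%N); last by move=> i; rewrite inE.
  by rewrite -(big_ord_widen 11 (fun=> 1%N)) // sum1_card card_ord.
move=> h; rewrite dual_golay11_dual golay11E mem_gen_code => /submxP [u uh] /suppP h0.
suff -> : h = 0 by rewrite trmx0 mulmx0.
rewrite uh -[u]mulmx1 -(gen_mx_systematic sys11) mulmxA -uh.
suff -> : h *m first_coords 11 (size rows11) = 0 by rewrite mul0mx.
apply/rowP => j; have j11 : (j < 11)%N by apply: ltn_trans (ltn_ord j) _.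
rewrite (@mul_first_coords _ _ _ (Ordinal j11)) // [RHS]mxE h0 // !inE negbK.
exact: ltn_ord j.
Qed.

Lemma lift_golay11_dual_not_UPWS :
  (2 <= m)%N -> ~ UPWS (lift_code iota golay11_dual).
Proof.
move=> m2; apply: (not_UPWS (W := [:: 5; 6; 7; 8; 9; 10; 11]%N)) => //.
  by rewrite ltnS; apply: covering_radius_le; exact: lift_golay11_dual_covers.
move=> w wW; rewrite dual_lift_golay11_dual.
exact: (union_weightsP iota cardL m2 golay11E _ union_weights11 wW).
Qed.

Lemma lift_golay11_not_UPWS :
  (2 <= m)%N -> covering_radius (lift_code iota golay11) = 4%N ->
  ~ UPWS (lift_code iota golay11).
Proof.
move=> m2 R4; apply: (not_UPWS (W := [:: 6; 8; 9; 10; 11]%N)); rewrite ?R4 //.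
move=> w wW; rewrite dual_lift_golay11.
exact: (union_weightsP iota cardL m2 golay11_dualE _ union_weights11d wW).
Qed.

Lemma lift_golay12_not_UPWS :
  (2 <= m)%N -> (covering_radius (lift_code iota golay12) < 6)%N ->
  ~ UPWS (lift_code iota golay12).
Proof.
move=> m2 R6; apply: (not_UPWS (W := [:: 6; 8; 9; 10; 11; 12]%N)) => //.
move=> w wW; rewrite dual_lift_golay12.
exact: (union_weightsP iota cardL m2 golay12E _ union_weights12 wW).
Qed.

End LiftedGolay.

Lemma covering_radius_lift_golay12_2 (L : finFieldType) (iota : {rmorphism 'F_3 -> L}) :
  #|L| = (3 ^ 2)%N -> covering_radius (lift_code iota golay12) = 4%N.
Proof.
move=> cardL; apply: covering_radiusP.
  exact: (pairs_coveredP iota cardL golay12E dual_golay12 _ sys12 pairs_covered12).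
apply: (uncoveredP iota cardL (rows := rows12)
  (X := map word_of_seq
   [:: [:: 0; 0; 0; 0; 0; 0; 0; 2; 0; 1; 0; 1];
       [:: 0; 0; 0; 0; 0; 0; 1; 1; 2; 1; 0; 0]]%N)) => //.
by rewrite dual_golay12 golay12E.
Qed.

(** * Extremal numbers of minimum weight words *)

Lemma weight_count7_eq0 (F : finFieldType) n (C : {vspace 'rV[F]_n}) :
  (forall x, x \in C -> wt x <> 7%N) -> weight_count 7 C = 0%N.
Proof. by move=> no7; apply: weight_count_eq0 => // c cC _; apply/eqP/no7. Qed.

Lemma Amax_attained (F : finFieldType) n (C : {vspace 'rV[F]_n}) k :
  (0 < k)%N -> code_params C k 6 -> near_MDS C ->
  (forall x, x \in C -> wt x <> 7%N) ->
  (weight_count 6 C)%:R = Amax n k #|F| /\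
  forall D : {vspace 'rV[F]_n}, code_params D k 6 -> near_MDS D ->
    (weight_count 6 D <= weight_count 6 C)%N.
Proof.
move=> k0 parC nmdsC no7; have [_] := Amax_of_near_MDS k0 parC nmdsC.
rewrite (weight_count7_eq0 no7) eqxx => /eqP AC; split=> // D parD nmdsD.
by rewrite -(ler_nat rat) AC (Amax_of_near_MDS k0 parD nmdsD).
Qed.

Lemma golay12_no_weight7 x : x \in golay12 -> wt x <> 7%N.
Proof.
move=> xC x7; have x0 : x != 0 by rewrite -wt_gt0 x7.
by have := golay12_weights xC x0; rewrite x7.
Qed.

Lemma golay11_dual_no_weight7 x : x \in golay11_dual -> wt x <> 7%N.
Proof.
move=> xC x7; have x0 : x != 0 by rewrite -wt_gt0 x7.
by have := golay11_dual_weights xC x0; rewrite x7.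
Qed.

Lemma weight_count6_golay12 : (weight_count 6 golay12)%:R = Amax 12 6 3.
Proof.
have [-> _] := Amax_attained (k := 6) isT golay12_params golay12_near_MDS golay12_no_weight7.
by rewrite card_Fp.
Qed.

Lemma weight_count6_golay11_dual : (weight_count 6 golay11_dual)%:R = Amax 11 5 3.
Proof.
have [-> _] := Amax_attained (k := 5) isT golay11_dual_params golay11_dual_near_MDS
  golay11_dual_no_weight7.
by rewrite card_Fp.
Qed.

Theorem theorem4p2 :
  (* (i) *)
  ([/\ code_paramsR golay12 6 6 3, UPWS golay12 & near_MDS golay12] /\
   (forall (m : nat) (F : finFieldType) (iota : {rmorphism 'F_3 -> F}),
      (6 <= m)%N -> #|F| = (3 ^ m)%N ->
      [/\ code_paramsR (lift_code iota golay12) 6 6 6,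
          UPWS (lift_code iota golay12) & near_MDS (lift_code iota golay12)]) /\
   [/\ code_paramsR golay11 6 5 2, UPWS golay11 & near_MDS golay11] /\
   (forall (m : nat) (F : finFieldType) (iota : {rmorphism 'F_3 -> F}),
      (4 <= m)%N -> #|F| = (3 ^ m)%N ->
      [/\ code_paramsR (lift_code iota golay11) 6 5 5,
          UPWS (lift_code iota golay11) & near_MDS (lift_code iota golay11)])) /\
  (* (ii) *)
  ((forall (m : nat) (F : finFieldType) (iota : {rmorphism 'F_3 -> F}),
      (2 <= m)%N -> #|F| = (3 ^ m)%N ->
      [/\ code_params (lift_code iota golay11_dual) 5 6,
          near_MDS (lift_code iota golay11_dual)
        & ~ UPWS (lift_code iota golay11_dual)]) /\
   (forall (m : nat) (F : finFieldType) (iota : {rmorphism 'F_3 -> F}),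
      m = 2%N \/ m = 3%N -> #|F| = (3 ^ m)%N ->
      [/\ code_paramsR (lift_code iota golay11) 6 5 4,
          near_MDS (lift_code iota golay11)
        & ~ UPWS (lift_code iota golay11)]) /\
   (forall (F : finFieldType) (iota : {rmorphism 'F_3 -> F}),
      #|F| = (3 ^ 2)%N ->
      [/\ code_paramsR (lift_code iota golay12) 6 6 4,
          near_MDS (lift_code iota golay12)
        & ~ UPWS (lift_code iota golay12)]) /\
   (forall (F : finFieldType) (iota : {rmorphism 'F_3 -> F}),
      #|F| = (3 ^ 3)%N ->
      [/\ code_paramsR (lift_code iota golay12) 6 6 5,
          near_MDS (lift_code iota golay12)
        & ~ UPWS (lift_code iota golay12)])) /\
  (* (iii) *)
  ((code_paramsR golay11_dual 5 6 5 /\ completely_regular golay11_dual) /\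
   (let P := puncture (ord_max : 'I_11) golay11_dual in
    [/\ code_paramsR P 5 5 4, self_dual_equiv P & completely_regular P]) /\
   (forall x : 'rV['F_3]_11,
      (x \in golay11_dual) = (x \in golay11) && (wt x \in [:: 0; 6; 9]%N))) /\
  (* (iv) *)
  ((forall (m : nat) (F : finFieldType) (iota : {rmorphism 'F_3 -> F}),
      (1 <= m)%N -> #|F| = (3 ^ m)%N ->
      [/\ (weight_count 6 (lift_code iota golay12))%:R = Amax 12 6 (3 ^ m),
          Amax 12 6 (3 ^ m) = ('C(12, 5))%:R * (((3 ^ m)%N%:R - 1) / 6%:R),
          code_params (lift_code iota golay12) 6 6 /\
          near_MDS (lift_code iota golay12)
        & forall D : {vspace 'rV[F]_12}, code_params D 6 6 -> near_MDS D ->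
            (weight_count 6 D <= weight_count 6 (lift_code iota golay12))%N]) /\
   (forall (m : nat) (F : finFieldType) (iota : {rmorphism 'F_3 -> F}),
      (1 <= m)%N -> #|F| = (3 ^ m)%N ->
      [/\ (weight_count 6 (lift_code iota golay11_dual))%:R = Amax 11 5 (3 ^ m),
          Amax 11 5 (3 ^ m) = ('C(11, 4))%:R * (((3 ^ m)%N%:R - 1) / 5%:R),
          code_params (lift_code iota golay11_dual) 5 6 /\
          near_MDS (lift_code iota golay11_dual)
        & forall D : {vspace 'rV[F]_11}, code_params D 5 6 -> near_MDS D ->
            (weight_count 6 D <= weight_count 6 (lift_code iota golay11_dual))%N]) /\
   ((weight_count 6 golay12)%:R = Amax 12 6 3 /\
    forall D : {vspace 'rV['F_3]_12}, code_params D 6 6 ->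
      (weight_count 6 golay12 <= weight_count 6 D)%N) /\
   ((weight_count 6 golay11_dual)%:R = Amax 11 5 3 /\
    forall D : {vspace 'rV['F_3]_11}, code_params D 5 6 ->
      (weight_count 6 golay11_dual <= weight_count 6 D)%N) /\
   (forall D : {vspace 'rV['F_3]_11}, code_params D 6 5 ->
      (weight_count 5 golay11 <= weight_count 5 D)%N)) /\
  (* (v) *)
  (forall (m : nat) (F : finFieldType) (iota : {rmorphism 'F_3 -> F}),
     (1 <= m)%N -> #|F| = (3 ^ m)%N ->
     (forall x : 'rV[F]_12, x \in lift_code iota golay12 -> wt x <> 7%N) /\
     (forall x : 'rV[F]_11, x \in lift_code iota golay11_dual -> wt x <> 7%N)).
Proof.
split; [|split; [|split; [|split]]].
- split; [|split; [|split]].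
  + split; [|apply: (UPWS_of_dual_weights (W := [:: 6; 9; 12]%N)) => //|].
    * by split; [exact: golay12_params|exact: covering_radius_golay12].
    * by rewrite dual_golay12; apply: golay12_weights.
    * exact: covering_radius_golay12.
    * exact: golay12_near_MDS.
  + move=> m F iota m6 cardF; have R6 := covering_radius_lift_golay12_ge6 iota cardF m6.
    split; last exact: lift_golay12_near_MDS cardF.
      by split; first exact: lift_golay12_params cardF.
    by apply: (UPWS_of_dual_weights (W := [:: 6; 8; 9; 10; 11; 12]%N)) R6 => //;
      exact: dual_lift_golay12_weights cardF.
  + split; [|apply: (UPWS_of_dual_weights (W := [:: 6; 9]%N)) => //|].
    * by split; [exact: golay11_params|exact: covering_radius_golay11].
    * exact: golay11_dual_weights.
    * exact: covering_radius_golay11.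
    * exact: golay11_near_MDS.
  + move=> m F iota m4 cardF; have R5 := covering_radius_lift_golay11_ge4 iota cardF m4.
    split; last exact: lift_golay11_near_MDS cardF.
      by split; first exact: lift_golay11_params cardF.
    by apply: (UPWS_of_dual_weights (W := [:: 6; 8; 9; 10; 11]%N)) R5 => //;
      exact: dual_lift_golay11_weights cardF.
- split; [|split; [|split]].
  + move=> m F iota m2 cardF; split.
    * exact: lift_golay11_dual_params cardF.
    * exact: lift_golay11_dual_near_MDS cardF.
    * exact: lift_golay11_dual_not_UPWS cardF m2.
  + move=> m F iota m23 cardF; have R4 := covering_radius_lift_golay11_23 iota cardF m23.
    split; [by split; first exact: lift_golay11_params cardF|exact: lift_golay11_near_MDS cardF|].
    by apply: lift_golay11_not_UPWS cardF _ R4; case: m23 => ->.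
  + move=> F iota cardF; have R4 := covering_radius_lift_golay12_2 iota cardF.
    split; [by split; first exact: lift_golay12_params cardF|exact: lift_golay12_near_MDS cardF|].
    by apply: (lift_golay12_not_UPWS cardF); rewrite ?R4.
  + move=> F iota cardF; have R5 := covering_radius_lift_golay12_3 iota cardF erefl.
    split; [by split; first exact: lift_golay12_params cardF|exact: lift_golay12_near_MDS cardF|].
    by apply: (lift_golay12_not_UPWS cardF); rewrite ?R5.
- split; [|split].
  + split; last exact: golay11_dual_regular.
    by split; [exact: golay11_dual_params|exact: covering_radius_golay11_dual].
  + rewrite puncture_golay11_dual; split; [|exact: code10_self_dual|exact: code10_regular].
    by split; [exact: code10_params|exact: covering_radius_code10].
  + exact: golay11_dual_memE.
- split; [|split; [|split; [|split]]].
  + move=> m F iota _ cardF; have params := lift_golay12_params iota cardF.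
    have nmds := lift_golay12_near_MDS iota cardF.
    have [A6 maxA6] := Amax_attained (k := 6) isT params nmds
      (@lift_golay12_no_weight7 _ _ iota cardF).
    by split; [rewrite A6 cardF|rewrite /Amax|exact: conj params nmds|exact: maxA6].
  + move=> m F iota _ cardF; have params := lift_golay11_dual_params iota cardF.
    have nmds := lift_golay11_dual_near_MDS iota cardF.
    have [A6 maxA6] := Amax_attained (k := 5) isT params nmds
      (@lift_golay11_dual_no_weight7 _ _ iota cardF).
    by split; [rewrite A6 cardF|rewrite /Amax|exact: conj params nmds|exact: maxA6].
  + split; first exact: weight_count6_golay12.
    move=> D /weight_count6_ge_12; apply: leq_trans.
    (* 792·2/6 = 264: the maximum for near-MDS codes meets the linear programming minimum for all
       codes. *)
    by rewrite -(ler_nat rat) weight_count6_golay12 /Amax; vm_compute.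
  + split; first exact: weight_count6_golay11_dual.
    move=> D /weight_count6_ge_11; apply: leq_trans.
    (* Likewise 330·2/5 = 132. *)
    by rewrite -(ler_nat rat) weight_count6_golay11_dual /Amax; vm_compute.
  + by move=> D /weight_count5_ge; rewrite weight_count5_golay11.
- move=> m F iota _ cardF; split.
    exact: lift_golay12_no_weight7 cardF.
  exact: lift_golay11_dual_no_weight7 cardF.
Qed.
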